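(* Let $K$ be a field and let $\Gamma_K$ be a $K$-rational quiver. The category $\operatorname{Rep}(\Gamma_K)$ of finite-dimensional $K$-rational representations of $\Gamma_K$ is equivalent to the category $\operatorname{Rep}(S(\Gamma_K))$ of finite-dimensional representations of its associated $K$-species $S(\Gamma_K)$.
   Context: Let $L/K$ be a (finite or infinite) Galois extension, $G=\operatorname{Gal}(L/K)$ with profinite topology. A $K$-rational quiver $\Gamma_K$ (with respect to $L/K$) is a quiver $\Gamma=(V,E,s,t)$ ($V,E$ finite sets, $s,t\colon E\to V$) with continuous left $G$-actions on the discrete sets $V$ and $E$ such that $s(\sigma e)=\sigma s(e)$ and $t(\sigma e)=\sigma t(e)$. A $K$-rational representation of $\Gamma_K$ consists of: $L$-vector spaces $M(v)$, $v\in V$; $\sigma$-linear isomorphisms $\varphi_{v,\sigma}\colon M(v)\to M(\sigma v)$ for $v\in V,\sigma\in G$ (i.e. additive with $\varphi_{v,\sigma}(am)=\sigma(a)\varphi_{v,\sigma}(m)$) with $\varphi_{\tau v,\sigma}\circ\varphi_{v,\tau}=\varphi_{v,\sigma\tau}$; and $L$-linear maps $\phi_e\colon M(s(e))\to M(t(e))$, $e\in E$, with $\phi_{\sigma e}\circ\varphi_{s(e),\sigma}=\varphi_{t(e),\sigma}\circ\phi_e$ for all $\sigma\in G$, $e\in E$. Galois actions are assumed continuous: for each $v$ and $m\in M(v)$ the stabilizer $\{\sigma\in G_v\mid\varphi_{v,\sigma}(m)=m\}$ is open in $G$. A morphism is a family of $L$-linear maps $\psi_v\colon M(v)\to N(v)$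 with $\psi_{t(e)}\circ\phi_e=\phi_e\circ\psi_{s(e)}$ and $\psi_{\sigma v}\circ\varphi_{v,\sigma}=\varphi_{v,\sigma}\circ\psi_v$. The representation is finite-dimensional if all $M(v)$ are. The species $S(\Gamma_K)=(L_i,{}_iM_j)_{i,j\in I}$: let $I=G\backslash V$, $E_{ij}=\{e\in E\mid s(e)\in i,\ t(e)\in j\}$; choose representatives $v_i\in i$ for $i\in I$ and $e_\varepsilon\in\varepsilon$ for each orbit $\varepsilon\in G\backslash E$. For a vertex or edge $x$ with stabilizer $G_x$ put $L(x)=L^{G_x}$. Set $L_i=L(v_i)$ and ${}_iM_j=\bigoplus_{\varepsilon\in G\backslash E_{ij}}L(e_\varepsilon)$, an $L_i,L_j$-bimodule where, for chosen $\sigma_\varepsilon,\tau_\varepsilon\in G$ with $s(e_\varepsilon)=\sigma_\varepsilon v_i$, $t(e_\varepsilon)=\tau_\varepsilon v_j$, $L_i$ acts on $L(e_\varepsilon)$ through $\sigma_\varepsilon\colon L(v_i)\to L(e_\varepsilon)$ and $L_j$ acts through $\tau_\varepsilon\colon L(v_j)\to L(e_\varepsilon)$. A representation of $S=(L_i,{}_iM_j)_{i,j\in I}$ is a family of finite-dimensional right $L_i$-vector spaces $W_i$, $i\in I$, with $L_j$-linear maps $f_{ij}\colon W_i\otimes_{L_i}{}_iM_j\to W_j$, $i,j\in I$. A morphism $(W,f)\to(W',f')$ is a family of $L_i$-linear maps $\psi_i\colon W_i\to W_i'$ with $\psi_j\circ f_{ij}=f'_{ij}\circ(\psi_i\otimes\mathbf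 1)$ for all $i,j$. *)

(* Defs.v *)
From HB Require Import structures.
From mathcomp Require Import all_boot all_order all_algebra all_field.
From mathcomp Require Import boolp classical_sets topology.

Set Implicit Arguments.
Unset Strict Implicit.
Unset Printing Implicit Defensive.

Import GRing.Theory.

Local Open Scope classical_set_scope.
Local Open Scope group_scope.
Local Open Scope ring_scope.
Local Open Scope quotient_scope.

Record category := Category {
  obj :> Type;
  hom : obj -> obj -> Type;
  idm : forall X, hom X X;
  compm : forall X Y Z, hom Y Z -> hom X Y -> hom X Z;
  comp1m : forall X Y (f : hom X Y), compm (idm Y) f = f;
  compm1 : forall X Y (f : hom X Y), compm f (idm X) = f;
  compA : forall X Y Z T (h : hom Z T) (g : hom Y Z) (f : hom X Y),
    compm h (compm g f) = compm (compm h g) f }.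

Record functor (C D : category) := Functor {
  fobj :> C -> D;
  fmap : forall X Y, hom X Y -> hom (fobj X) (fobj Y);
  fmap1 : forall X, fmap (idm X) = idm (fobj X);
  fmapM : forall X Y Z (g : hom Y Z) (f : hom X Y),
    fmap (compm g f) = compm (fmap g) (fmap f) }.

Definition functor_id (C : category) : functor C C :=
  @Functor C C id (fun _ _ f => f) (fun=> erefl) (fun _ _ _ _ _ => erefl).

Lemma functor_comp1 (C D E : category) (G : functor D E) (F : functor C D) X :
  fmap G (fmap F (idm X)) = idm (G (F X)).
Proof. by rewrite !fmap1. Qed.

Lemma functor_compM (C D E : category) (G : functor D E) (F : functor C D)
    X Y Z (g : hom Y Z) (f : hom X Y) :
  fmap G (fmap F (compm g f)) = compm (fmap G (fmap F g)) (fmap G (fmap F f)).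
Proof. by rewrite !fmapM. Qed.

Definition functor_comp (C D E : category) (G : functor D E)
    (F : functor C D) : functor C E :=
  @Functor C E (fun X => G (F X)) (fun _ _ f => fmap G (fmap F f))
    (functor_comp1 G F) (functor_compM G F).

Record natiso (C D : category) (F G : functor C D) := NatIso {
  niso : forall X, hom (F X) (G X);
  niso_inv : forall X, hom (G X) (F X);
  nisoK : forall X, compm (niso_inv X) (niso X) = idm (F X);
  niso_invK : forall X, compm (niso X) (niso_inv X) = idm (G X);
  niso_nat : forall X Y (f : hom X Y),
    compm (fmap G f) (niso X) = compm (niso Y) (fmap F f) }.

Definition equivalent_categories (C D : category) : Prop :=
  exists (F : functor C D) (G : functor D C),
    inhabited (natiso (functor_comp G F) (functor_id C)) /\
    inhabited (natiso (functor_comp F G) (functor_id D)).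

Definition is_galois (K L : fieldType) (iota : {rmorphism K -> L}) : Prop :=
  [/\ forall x : L, algebraicOver iota x,
      forall p : {poly K}, irreducible_poly p ->
        (exists x : L, root (map_poly iota p) x) ->
        exists s : seq L, map_poly iota p %= \prod_(x <- s) ('X - x%:P)
    & forall p : {poly K}, irreducible_poly p ->
        (exists x : L, root (map_poly iota p) x) -> separable_poly p].

Lemma rmorphism_ext (R S : pzSemiRingType) (f g : {rmorphism R -> S}) :
  f =1 g -> f = g.
Proof.
case: f g => [f [[f1] [f2]]] [g [[g1] [g2]]] /= /funext fg.
case: g / fg in g1 g2 *.
by rewrite (Prop_irrelevance f1 g1) (Prop_irrelevance f2 g2).
Qed.

Section GaloisGroup.
Variables (K L : fieldType) (iota : {rmorphism K -> L}).

Record gal := Gal {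
  gal_fun :> {rmorphism L -> L};
  gal_bij : bijective gal_fun;
  gal_fix : forall a, gal_fun (iota a) = iota a }.

Lemma gal_ext (s t : gal) : s =1 t -> s = t.
Proof.
case: s t => [f bf ff] [g bg fg] /= /rmorphism_ext e; case: g / e in bg fg *.
by rewrite (Prop_irrelevance bf bg) (Prop_irrelevance ff fg).
Qed.

HB.instance Definition _ := gen_eqMixin gal.
HB.instance Definition _ := gen_choiceMixin gal.

Definition gal_one : gal := @Gal idfun (Bijective (frefl _) (frefl _)) (frefl _).

Lemma gal_mul_fix (s t : gal) a : (s \o t) (iota a) = iota a.
Proof. by rewrite /= !gal_fix. Qed.

Definition gal_mul (s t : gal) : gal :=
  @Gal (GRing.RMorphism.clone _ _ (s \o t) _)
    (bij_comp (gal_bij s) (gal_bij t)) (gal_mul_fix s t).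

Lemma gal_inv_subproof (s : gal) :
  {t : gal | cancel s t /\ cancel t s}.
Proof.
apply: cid; have [g sK gK] := gal_bij s.
have gB : zmod_morphism g.
  by move=> x y; apply: (can_inj sK); rewrite rmorphB !gK.
have gM : monoid_morphism g.
  split=> [|x y]; apply: (can_inj sK); first by rewrite gK rmorph1.
  by rewrite rmorphM !gK.
pose zg := GRing.isZmodMorphism.Build L L g gB.
pose mg := GRing.isMonoidMorphism.Build L L g gM.
pose rg : {rmorphism L -> L} := HB.pack g zg mg.
have rg_bij : bijective rg by exists s.
have rg_fix a : rg (iota a) = iota a.
  by apply: (can_inj sK); rewrite /= gK gal_fix.
by exists (Gal rg_bij rg_fix).
Qed.

Definition gal_inv (s : gal) : gal := sval (gal_inv_subproof s).

Lemma gal_mulA : associative gal_mul.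
Proof. by move=> s t u; apply: gal_ext. Qed.
Lemma gal_mul1 : left_id gal_one gal_mul.
Proof. by move=> s; apply: gal_ext. Qed.
Lemma gal_mulr1 : right_id gal_one gal_mul.
Proof. by move=> s; apply: gal_ext. Qed.
Lemma gal_mulV : left_inverse gal_one gal_inv gal_mul.
Proof.
move=> s; apply: gal_ext => x.
by rewrite /= /gal_inv; case: (gal_inv_subproof s) => t /= [-> _].
Qed.
Lemma gal_mulrV : right_inverse gal_one gal_inv gal_mul.
Proof.
move=> s; apply: gal_ext => x.
by rewrite /= /gal_inv; case: (gal_inv_subproof s) => t /= [_ ->].
Qed.

HB.instance Definition _ := isGroup.Build gal
  gal_mulA gal_mul1 gal_mulr1 gal_mulV gal_mulrV.

(* Krull topology: the automorphisms agreeing with s on the finite set r are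
   the coset s Gal(L / K(r)); when L / K is algebraic these are the cosets of
   the subgroups Gal(L / F), F / K finite, and the topology is profinite. *)
Definition gal_open : set (set gal) := [set U | forall s : gal, U s ->
  exists r : seq L, forall t : gal, {in r, t =1 s} -> U t].

Lemma gal_openT : gal_open setT.
Proof. by move=> s _; exists [::]. Qed.

Lemma gal_openI : setI_closed gal_open.
Proof.
move=> U U' oU oU' s [/oU[r rU] /oU'[r' rU']]; exists (r ++ r') => t ts.
by split; [apply: rU | apply: rU'] => x xr; apply: ts; rewrite mem_cat xr ?orbT.
Qed.

Lemma gal_open_bigU (I : Type) (f : I -> set gal) :
  (forall i, gal_open (f i)) -> gal_open (\bigcup_i f i).
Proof. by move=> of_ s [i _ /of_[r rf]]; exists r => t /rf ?; exists i. Qed.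

HB.instance Definition _ := isOpenTopological.Build gal
  gal_openT gal_openI gal_open_bigU.

Record galset := GalSet {
  galset_sort :> finType;
  act : gal -> galset_sort -> galset_sort;
  act1 : forall x, act 1%g x = x;
  actM : forall s t x, act (s * t)%g x = act s (act t x);
  act_continuous :
    continuous (fun p : gal * discrete_topology galset_sort =>
      act p.1 p.2 : discrete_topology galset_sort) }.

Definition stab (X : galset) (x : X) : set gal := [set s | act s x = x].

Definition gal_orbit (X : galset) (x : X) : {set X} :=
  [set y | `[< exists s : gal, y = act s x >]]%SET.

Definition orbits (X : galset) : finType :=
  {A : {set X} | [exists x, A == gal_orbit x]}.

Definition fixed (H : set gal) : pred L :=
  fun x => `[< forall s : gal, H s -> s x = x >].

Lemma fixed_divring H : divring_closed (fixed H).
Proof.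
split=> [|x y /asboolP hx /asboolP hy|x y /asboolP hx /asboolP hy];
  apply/asboolP => s Hs; first exact: rmorph1.
- by rewrite rmorphB hx // hy.
- by rewrite fmorph_div hx // hy.
Qed.

HB.instance Definition _ H :=
  GRing.isDivringClosed.Build L (fixed H) (fixed_divring H).

Record fixfield (H : set gal) := FixField {
  fixval :> L;
  fixvalP : fixval \in fixed H }.

HB.instance Definition _ H := [isSub for @fixval H].
HB.instance Definition _ H := [Choice of fixfield H by <:].
HB.instance Definition _ H :=
  [SubChoice_isSubIntegralDomain of fixfield H by <:].
HB.instance Definition _ H :=
  [SubIntegralDomain_isSubField of fixfield H by <:].

(* The homomorphism L^H -> L^H', a |-> s a, for H' contained in s H s^-1. *)
Section FixedMap.
Variables (H H' : set gal) (s : gal).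
Hypothesis sH : forall t, H' t -> H (s^-1 * t * s)%g.

Lemma fixmap_subproof (a : fixfield H) : s (fixval a) \in fixed H'.
Proof.
apply/asboolP => t /sH /(asboolP _ (fixvalP a)) {2}<-.
have -> : s ((s^-1 * t * s)%g (fixval a)) = (s * (s^-1 * t * s))%g (fixval a).
  by [].
by rewrite !mulgA mulgV mul1g.
Qed.

Definition fixmap (a : fixfield H) : fixfield H' :=
  FixField (fixmap_subproof a).

Lemma fixmap_zmod_morphism : zmod_morphism fixmap.
Proof. by move=> a b; apply: val_inj; rewrite /= rmorphB. Qed.

Lemma fixmap_monoid_morphism : monoid_morphism fixmap.
Proof. by split=> [|a b]; apply: val_inj; rewrite /= ?rmorph1 ?rmorphM. Qed.

HB.instance Definition _ := GRing.isZmodMorphism.Build _ _ fixmap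
  fixmap_zmod_morphism.
HB.instance Definition _ := GRing.isMonoidMorphism.Build _ _ fixmap
  fixmap_monoid_morphism.

End FixedMap.

Lemma stab_conj (X Y : galset) (x : X) (y : Y) (s : gal) :
  stab y `<=` stab (act s x) ->
  forall t, stab y t -> stab x (s^-1 * t * s)%g.
Proof.
move=> yx t /yx xt; rewrite /stab /= !actM [act t _]xt -actM.
by rewrite mulVg act1.
Qed.

End GaloisGroup.

Arguments act {K L iota g} s x.

Section RationalQuivers.
Variables (K L : fieldType) (iota : {rmorphism K -> L}).

Record ratquiver := RatQuiver {
  vert : galset iota;
  edge : galset iota;
  src : edge -> vert;
  tgt : edge -> vert;
  src_act : forall s e, src (act s e) = act s (src e);
  tgt_act : forall s e, tgt (act s e) = act s (tgt e) }.

Record ratrep (Q : ratquiver) := RatRep {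
  rep_sp :> forall v : vert Q, vectType L;
  rep_act : forall v s, rep_sp v -> rep_sp (act s v);
  rep_map : forall e : edge Q, 'Hom(rep_sp (src e), rep_sp (tgt e));
  rep_act_add : forall v s m n,
    rep_act s (m + n) = rep_act s m + rep_act s n :> rep_sp (act s v);
  rep_act_semilinear : forall v (s : gal iota) (a : L) (m : rep_sp v),
    rep_act s (a *: m) = s a *: rep_act s m;
  rep_act_bij : forall v s, bijective (@rep_act v s);
  rep_actM : forall v s t (m : rep_sp v),
    rep_act s (rep_act t m)
      = ecast w (rep_sp w) (actM s t v) (rep_act (s * t)%g m);
  rep_map_act : forall s e (m : rep_sp (src e)),
    rep_map (act s e) (ecast w (rep_sp w) (esym (src_act s e)) (rep_act s m))
      = ecast w (rep_sp w) (esym (tgt_act s e)) (rep_act s (rep_map e m));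
  rep_act_continuous : forall v (m : rep_sp v),
    open [set s : gal iota | exists sv : act s v = v,
      ecast w (rep_sp w) sv (rep_act s m) = m] }.

Record ratrep_hom (Q : ratquiver) (M N : ratrep Q) := RatRepHom {
  ratrep_hom_fun :> forall v, 'Hom(M v, N v);
  ratrep_hom_map : forall e (m : M (src e)),
    ratrep_hom_fun (tgt e) (rep_map M e m)
      = rep_map N e (ratrep_hom_fun (src e) m);
  ratrep_hom_act : forall v s (m : M v),
    ratrep_hom_fun (act s v) (rep_act s m) = rep_act s (ratrep_hom_fun v m) }.

Lemma ratrep_hom_ext (Q : ratquiver) (M N : ratrep Q) (f g : ratrep_hom M N) :
  (forall v, f v =1 g v) -> f = g.
Proof.
case: f g => [f f1 f2] [g g1 g2] /= fg.
have e : f = g.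
  by apply: functional_extensionality_dep => v; apply/lfunP; apply: fg.
case: g / e in g1 g2 {fg} *.
by rewrite (Prop_irrelevance f1 g1) (Prop_irrelevance f2 g2).
Qed.

Obligation Tactic := idtac.

Program Definition ratrep_id (Q : ratquiver) (M : ratrep Q) : ratrep_hom M M :=
  @RatRepHom Q M M (fun v => \1%VF) _ _.
Next Obligation. by move=> *; rewrite !id_lfunE. Qed.
Next Obligation. by move=> *; rewrite !id_lfunE. Qed.

Program Definition ratrep_comp (Q : ratquiver) (M N P : ratrep Q)
    (g : ratrep_hom N P) (f : ratrep_hom M N) : ratrep_hom M P :=
  @RatRepHom Q M P (fun v => (g v \o f v)%VF) _ _.
Next Obligation. by move=> *; rewrite !comp_lfunE !ratrep_hom_map. Qed.
Next Obligation. by move=> *; rewrite !comp_lfunE !ratrep_hom_act. Qed.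

Program Definition ratrep_category (Q : ratquiver) : category :=
  @Category (ratrep Q) (@ratrep_hom Q) (@ratrep_id Q) (@ratrep_comp Q) _ _ _.
Next Obligation.
by move=> *; apply: ratrep_hom_ext => v m; rewrite /= !(comp_lfunE, id_lfunE).
Qed.
Next Obligation.
by move=> *; apply: ratrep_hom_ext => v m; rewrite /= !(comp_lfunE, id_lfunE).
Qed.
Next Obligation.
by move=> *; apply: ratrep_hom_ext => v m; rewrite /= !(comp_lfunE, id_lfunE).
Qed.

End RationalQuivers.

Record bimodule (F F' : fieldType) := Bimodule {
  bimod_sort :> zmodType;
  lact : F -> bimod_sort -> bimod_sort;
  ract : bimod_sort -> F' -> bimod_sort;
  lact1 : forall m, lact 1 m = m;
  lactA : forall a b m, lact (a * b) m = lact a (lact b m);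
  lactDl : forall a b m, lact (a + b) m = lact a m + lact b m;
  lactDr : forall a m n, lact a (m + n) = lact a m + lact a n;
  ract1 : forall m, ract m 1 = m;
  ractA : forall m a b, ract m (a * b) = ract (ract m a) b;
  ractDl : forall m n a, ract (m + n) a = ract m a + ract n a;
  ractDr : forall m a b, ract m (a + b) = ract m a + ract m b;
  lract : forall a m b, ract (lact a m) b = lact a (ract m b) }.

(* F and F' are commutative, so a right F-vector space is an [lmodType F]. *)
Section Tensor.
Variables (F F' : fieldType) (W : lmodType F) (M : bimodule F F').

(* W (x) M is the set of formal sums of pairs (w, m) modulo the smallest
   congruence below. *)
Inductive tensor_eq : seq (W * M) -> seq (W * M) -> Prop :=
| TensorRefl r : tensor_eq r r
| TensorSym r s : tensor_eq r s -> tensor_eq s r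
| TensorTrans r s t : tensor_eq r s -> tensor_eq s t -> tensor_eq r t
| TensorCat r s t u :
    tensor_eq r s -> tensor_eq t u -> tensor_eq (r ++ t) (s ++ u)
| TensorCatC r s : tensor_eq (r ++ s) (s ++ r)
| TensorDl w w' m : tensor_eq [:: (w + w', m)] [:: (w, m); (w', m)]
| TensorDr w m m' : tensor_eq [:: (w, m + m')] [:: (w, m); (w, m')]
| Tensor0 m : tensor_eq [:: (0, m)] [::]
| TensorZ a w m : tensor_eq [:: (a *: w, m)] [:: (w, lact a m)].

Definition tensor_eqb (r s : seq (W * M)) := `[< tensor_eq r s >].

Lemma tensor_eqb_refl : reflexive tensor_eqb.
Proof. by move=> r; apply/asboolP; apply: TensorRefl. Qed.
Lemma tensor_eqb_sym : symmetric tensor_eqb.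
Proof.
by move=> r s; apply/asbool_equiv_eq; split; apply: TensorSym.
Qed.
Lemma tensor_eqb_trans : transitive tensor_eqb.
Proof.
by move=> s r t /asboolP rs /asboolP st; apply/asboolP; apply: TensorTrans st.
Qed.

Canonical tensor_equiv :=
  EquivRel tensor_eqb tensor_eqb_refl tensor_eqb_sym tensor_eqb_trans.

Definition tensor : Type := {eq_quot tensor_equiv}.

HB.instance Definition _ := Choice.on tensor.

Definition tensor_of (r : seq (W * M)) : tensor := \pi_{eq_quot tensor_equiv} r.
Definition tensor_repr (x : tensor) : seq (W * M) :=
  repr (x : {eq_quot tensor_equiv}).

Lemma tensor_ofE r s : tensor_of r = tensor_of s <-> tensor_eq r s.
Proof.
split=> [/eqP|rs]; first by rewrite /tensor_of piE => /asboolP.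
by apply/eqP; rewrite /tensor_of piE; apply/asboolP.
Qed.

Lemma tensor_reprK x : tensor_of (tensor_repr x) = x.
Proof. exact: reprK. Qed.

Definition pure (w : W) (m : M) : tensor := tensor_of [:: (w, m)].

Definition tensor_zero := tensor_of [::].
Definition tensor_add x y := tensor_of (tensor_repr x ++ tensor_repr y).
Definition tensor_opp x :=
  tensor_of [seq (- p.1, p.2) | p <- tensor_repr x].
Definition tensor_scale (b : F') x :=
  tensor_of [seq (p.1, ract p.2 b) | p <- tensor_repr x].

Lemma lact_zero m : lact 0 m = 0 :> M.
Proof. by apply: (addrI (lact 0 m)); rewrite -lactDl !addr0. Qed.

Lemma ract_zero b : ract 0 b = 0 :> M.
Proof. by apply: (addrI (ract 0 b)); rewrite -ractDl !addr0. Qed.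

Lemma tensor_eq_opp r s : tensor_eq r s ->
  tensor_eq [seq (- p.1, p.2) | p <- r] [seq (- p.1, p.2) | p <- s].
Proof.
elim=> /= {r s}; do ?by constructor.
- by move=> r s t _ rs _; apply: TensorTrans.
- by move=> r s t u _ rs _ tu; rewrite !map_cat; apply: TensorCat.
- by move=> r s; rewrite !map_cat; apply: TensorCatC.
- by move=> w w' m; rewrite opprD; apply: TensorDl.
- by move=> m; rewrite oppr0; apply: Tensor0.
- by move=> a w m; rewrite -scalerN; apply: TensorZ.
Qed.

Lemma tensor_eq_scale b r s : tensor_eq r s ->
  tensor_eq [seq (p.1, ract p.2 b) | p <- r] [seq (p.1, ract p.2 b) | p <- s].
Proof.
elim=> /= {r s}; do ?by constructor.
- by move=> r s t _ rs _; apply: TensorTrans.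
- by move=> r s t u _ rs _ tu; rewrite !map_cat; apply: TensorCat.
- by move=> r s; rewrite !map_cat; apply: TensorCatC.
- by move=> w m m'; rewrite ractDl; apply: TensorDr.
- by move=> a w m; rewrite lract; apply: TensorZ.
Qed.

Lemma tensor_of_cat r s : tensor_add (tensor_of r) (tensor_of s) = tensor_of (r ++ s).
Proof.
by apply/tensor_ofE; apply: TensorCat; apply/tensor_ofE; rewrite tensor_reprK.
Qed.

Lemma tensor_of_opp r :
  tensor_opp (tensor_of r) = tensor_of [seq (- p.1, p.2) | p <- r].
Proof.
by apply/tensor_ofE/tensor_eq_opp/tensor_ofE; rewrite tensor_reprK.
Qed.

Lemma tensor_of_scale b r :
  tensor_scale b (tensor_of r) = tensor_of [seq (p.1, ract p.2 b) | p <- r].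
Proof.
by apply/tensor_ofE/tensor_eq_scale/tensor_ofE; rewrite tensor_reprK.
Qed.

Lemma tensor_ofP x : exists r, x = tensor_of r.
Proof. by exists (tensor_repr x); rewrite tensor_reprK. Qed.

Lemma tensor_addA : associative tensor_add.
Proof.
move=> x y z; have [r ->] := tensor_ofP x; have [s ->] := tensor_ofP y.
have [t ->] := tensor_ofP z.
by rewrite !tensor_of_cat catA.
Qed.

Lemma tensor_addC : commutative tensor_add.
Proof.
move=> x y; have [r ->] := tensor_ofP x; have [s ->] := tensor_ofP y.
by rewrite !tensor_of_cat; apply/tensor_ofE; apply: TensorCatC.
Qed.

Lemma tensor_add0 : left_id tensor_zero tensor_add.
Proof. by move=> x; have [r ->] := tensor_ofP x; rewrite tensor_of_cat. Qed.

Lemma tensor_addN : left_inverse tensor_zero tensor_opp tensor_add.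
Proof.
move=> x; have [r ->] := tensor_ofP x; rewrite tensor_of_opp tensor_of_cat.
apply/tensor_ofE; elim: r => [|[w m] r IHr] /=; first exact: TensorRefl.
set r' := map _ _ in IHr *; rewrite -cat1s -[(w, m) :: r]cat1s.
apply: (TensorTrans (s := [::] ++ [::])); last exact: TensorRefl.
apply: (@TensorTrans _ (([:: (- w, m)] ++ [:: (w, m)]) ++ (r' ++ r))).
  rewrite -!catA; apply: TensorCat; first exact: TensorRefl.
  rewrite !catA; apply: TensorCat; [exact: TensorCatC | exact: TensorRefl].
apply: TensorCat IHr.
apply: TensorTrans (Tensor0 m); rewrite -(addNr w); apply: TensorSym.
exact: TensorDl.
Qed.

HB.instance Definition _ := GRing.isZmodule.Build tensor
  tensor_addA tensor_addC tensor_add0 tensor_addN.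

Lemma tensor_ofD r s : tensor_of (r ++ s) = tensor_of r + tensor_of s.
Proof. by rewrite -tensor_of_cat. Qed.

Lemma tensor_of_sum r : tensor_of r = \sum_(p <- r) pure p.1 p.2.
Proof.
elim: r => [|[w m] r IHr]; first by rewrite big_nil.
by rewrite big_cons -cat1s tensor_ofD IHr.
Qed.

Lemma pureDl w w' m : pure (w + w') m = pure w m + pure w' m.
Proof. by rewrite -tensor_ofD; apply/tensor_ofE; apply: TensorDl. Qed.

Lemma pureDr w m m' : pure w (m + m') = pure w m + pure w m'.
Proof. by rewrite -tensor_ofD; apply/tensor_ofE; apply: TensorDr. Qed.

Lemma pure0l m : pure 0 m = 0.
Proof. by apply/tensor_ofE; apply: Tensor0. Qed.

Lemma pureZ a w m : pure (a *: w) m = pure w (lact a m).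
Proof. by apply/tensor_ofE; apply: TensorZ. Qed.

Lemma tensor_scaleA b c x :
  tensor_scale b (tensor_scale c x) = tensor_scale (b * c) x.
Proof.
have [r ->] := tensor_ofP x; rewrite !tensor_of_scale -map_comp.
by congr tensor_of; apply: eq_map => -[w m] /=; rewrite [b * c]mulrC ractA.
Qed.

Lemma tensor_scale1 : left_id 1 tensor_scale.
Proof.
move=> x; have [r ->] := tensor_ofP x; rewrite tensor_of_scale map_id_in //.
by move=> [w m] _ /=; rewrite ract1.
Qed.

Lemma tensor_scaleDr : right_distributive tensor_scale +%R.
Proof.
move=> b x y; have [r ->] := tensor_ofP x; have [s ->] := tensor_ofP y.
by rewrite -tensor_ofD !tensor_of_scale -tensor_ofD map_cat.
Qed.

Lemma tensor_scaleDl x : {morph tensor_scale^~ x : b c / b + c}.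
Proof.
move=> b c; have [r ->] := tensor_ofP x; rewrite !tensor_of_scale.
rewrite !tensor_of_sum !big_map -big_split; apply: eq_bigr => -[w m] _ /=.
by rewrite ractDr pureDr.
Qed.

HB.instance Definition _ := GRing.Zmodule_isLmodule.Build F' tensor
  tensor_scaleA tensor_scale1 tensor_scaleDr tensor_scaleDl.

Lemma scale_pure b w m : b *: pure w m = pure w (ract m b).
Proof. exact: tensor_of_scale. Qed.

Lemma tensorE x : exists r : seq (W * M), x = \sum_(p <- r) pure p.1 p.2.
Proof. by have [r ->] := tensor_ofP x; exists r; rewrite tensor_of_sum. Qed.

(* The universal property: tensor_lift f is the F'-linear map induced by an
   F-balanced biadditive map f that is F'-linear on the right. *)
Section Lift.
Variables (U : lmodType F') (f : W -> M -> U).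

Definition balanced : Prop :=
  [/\ forall w w' m, f (w + w') m = f w m + f w' m,
      forall w m m', f w (m + m') = f w m + f w m',
      forall a w m, f (a *: w) m = f w (lact a m)
    & forall w m b, f w (ract m b) = b *: f w m].

Definition tensor_lift (x : tensor) : U := \sum_(p <- tensor_repr x) f p.1 p.2.

Hypothesis fbal : balanced.

Lemma tensor_lift_of r : tensor_lift (tensor_of r) = \sum_(p <- r) f p.1 p.2.
Proof.
have [fDl fDr fZ _] := fbal.
have: tensor_eq (tensor_repr (tensor_of r)) r.
  by apply/tensor_ofE; rewrite tensor_reprK.
rewrite /tensor_lift; move: (tensor_repr _) => r0; elim=> //= {r0 r}.
- by move=> r s t _ -> _ ->.
- by move=> r s t u _ rs _ tu; rewrite !big_cat /= rs tu.
- by move=> r s; rewrite !big_cat /= addrC.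
- by move=> w w' m; rewrite !big_cons !big_nil !addr0 fDl.
- by move=> w m m'; rewrite !big_cons !big_nil !addr0 fDr.
- move=> m; rewrite big_seq1 big_nil /=.
  by apply: (addrI (f 0 m)); rewrite -fDl !addr0.
- by move=> a w m; rewrite !big_seq1 fZ.
Qed.

Lemma tensor_lift_linear : linear tensor_lift.
Proof.
have [_ _ _ fZr] := fbal.
move=> b x y; have [r ->] := tensor_ofP x; have [s ->] := tensor_ofP y.
have -> : b *: tensor_of r = tensor_of [seq (p.1, ract p.2 b) | p <- r].
  exact: tensor_of_scale.
rewrite -tensor_ofD !tensor_lift_of big_cat big_map scaler_sumr.
by congr (_ + _); apply: eq_bigr => p _; apply: fZr.
Qed.

Lemma tensor_lift_pure w m : tensor_lift (pure w m) = f w m.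
Proof. by rewrite tensor_lift_of big_seq1. Qed.

End Lift.

Lemma tensor_linear_ext (U : lmodType F') (f g : {linear tensor -> U}) :
  (forall w m, f (pure w m) = g (pure w m)) -> f =1 g.
Proof.
move=> fg x; have [r ->] := tensorE x; rewrite !linear_sum.
by apply: eq_bigr => p _; apply: fg.
Qed.

End Tensor.

(* tensor_map psi is psi (x) 1. *)
Section TensorMap.
Variables (F F' : fieldType) (M : bimodule F F').
Variables (W W' : lmodType F) (psi : {linear W -> W'}).

Definition tensor_map : tensor W M -> tensor W' M :=
  tensor_lift (fun w m => pure (psi w) m).

Lemma tensor_map_balanced : balanced (fun w (m : M) => pure (psi w) m).
Proof.
split=> *; by rewrite ?(linearD, linearZ) /= ?(pureDl, pureDr, pureZ, scale_pure).
Qed.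

HB.instance Definition _ := GRing.isLinear.Build F' (tensor W M) (tensor W' M)
  *:%R tensor_map (tensor_lift_linear tensor_map_balanced).

Lemma tensor_map_pure w m : tensor_map (pure w m) = pure (psi w) m.
Proof. exact: (tensor_lift_pure tensor_map_balanced). Qed.

End TensorMap.

Arguments tensor_map {F F'} M {W W'} psi.

Section BimoduleOfMorphisms.
Variables (F F' E : fieldType) (f : {rmorphism F -> E}) (g : {rmorphism F' -> E}).

Program Definition bimodule_of : bimodule F F' :=
  @Bimodule F F' E (fun a m => f a * m) (fun m b => m * g b)
    _ _ _ _ _ _ _ _ _.
Next Obligation. by move=> * /=; rewrite rmorph1 mul1r. Qed.
Next Obligation. by move=> * /=; rewrite rmorphM mulrA. Qed.
Next Obligation. by move=> * /=; rewrite rmorphD mulrDl. Qed.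
Next Obligation. by move=> * /=; rewrite mulrDr. Qed.
Next Obligation. by move=> * /=; rewrite rmorph1 mulr1. Qed.
Next Obligation. by move=> * /=; rewrite rmorphM mulrA. Qed.
Next Obligation. by move=> * /=; rewrite mulrDl. Qed.
Next Obligation. by move=> * /=; rewrite rmorphD mulrDr. Qed.
Next Obligation. by move=> * /=; rewrite mulrA. Qed.

End BimoduleOfMorphisms.

Section DirectSum.
Variables (F F' : fieldType) (T : finType) (M : T -> bimodule F F').

(* As T is finite, the direct sum is the product. *)
Definition dsum : Type := forall t, M t.

HB.instance Definition _ := Choice.copy dsum (forall t, M t).

Definition dsum_zero : dsum := fun=> 0.
Definition dsum_add (x y : dsum) : dsum := fun t => x t + y t.
Definition dsum_opp (x : dsum) : dsum := fun t => - x t.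

Lemma dsum_addA : associative dsum_add.
Proof. by move=> *; apply: functional_extensionality_dep => t; apply: addrA. Qed.
Lemma dsum_addC : commutative dsum_add.
Proof. by move=> *; apply: functional_extensionality_dep => t; apply: addrC. Qed.
Lemma dsum_add0 : left_id dsum_zero dsum_add.
Proof. by move=> *; apply: functional_extensionality_dep => t; apply: add0r. Qed.
Lemma dsum_addN : left_inverse dsum_zero dsum_opp dsum_add.
Proof. by move=> *; apply: functional_extensionality_dep => t; apply: addNr. Qed.

HB.instance Definition _ := GRing.isZmodule.Build dsum
  dsum_addA dsum_addC dsum_add0 dsum_addN.

Program Definition bimodule_sum : bimodule F F' :=
  @Bimodule F F' dsum (fun a m t => lact a (m t)) (fun m b t => ract (m t) b)
    _ _ _ _ _ _ _ _ _.
Next Obligation. by move=> *; apply: functional_extensionality_dep => t; apply: lact1. Qed.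
Next Obligation. by move=> *; apply: functional_extensionality_dep => t; apply: lactA. Qed.
Next Obligation. by move=> *; apply: functional_extensionality_dep => t; apply: lactDl. Qed.
Next Obligation. by move=> *; apply: functional_extensionality_dep => t; apply: lactDr. Qed.
Next Obligation. by move=> *; apply: functional_extensionality_dep => t; apply: ract1. Qed.
Next Obligation. by move=> *; apply: functional_extensionality_dep => t; apply: ractA. Qed.
Next Obligation. by move=> *; apply: functional_extensionality_dep => t; apply: ractDl. Qed.
Next Obligation. by move=> *; apply: functional_extensionality_dep => t; apply: ractDr. Qed.
Next Obligation. by move=> *; apply: functional_extensionality_dep => t; apply: lract. Qed.

End DirectSum.

Record species := Species {
  sp_index : finType;
  sp_field : sp_index -> fieldType;
  sp_bimod : forall i j, bimodule (sp_field i) (sp_field j) }.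

(* sprep_sp i is a right sp_field i-space: the fields are commutative. *)
Record sprep (S : species) := SpRep {
  sprep_sp :> forall i : sp_index S, vectType (sp_field i);
  sprep_map : forall i j,
    {linear tensor (sprep_sp i) (sp_bimod i j) -> sprep_sp j} }.

Record sprep_hom (S : species) (W W' : sprep S) := SpRepHom {
  sprep_hom_fun :> forall i, 'Hom(W i, W' i);
  sprep_hom_map : forall i j (x : tensor (W i) (sp_bimod i j)),
    sprep_hom_fun j (sprep_map W i j x)
      = sprep_map W' i j (tensor_map (sp_bimod i j) (sprep_hom_fun i) x) }.

Lemma sprep_hom_ext (S : species) (W W' : sprep S) (f g : sprep_hom W W') :
  (forall i, f i =1 g i) -> f = g.
Proof.
case: f g => [f fP] [g gP] /= fg; have e : f = g.
  by apply: functional_extensionality_dep => i; apply/lfunP; apply: fg.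
by case: g / e in gP {fg} *; rewrite (Prop_irrelevance fP gP).
Qed.

Program Definition sprep_id (S : species) (W : sprep S) : sprep_hom W W :=
  @SpRepHom S W W (fun i => \1%VF) _.
Next Obligation.
move=> S W i j x; rewrite id_lfunE; congr (sprep_map _ _ _ _).
apply: (@tensor_linear_ext _ _ _ _ _ idfun (tensor_map _ _)) => w m.
by rewrite /= tensor_map_pure; congr pure; rewrite -[LHS]id_lfunE.
Qed.

Program Definition sprep_comp (S : species) (W W' W'' : sprep S)
    (g : sprep_hom W' W'') (f : sprep_hom W W') : sprep_hom W W'' :=
  @SpRepHom S W W'' (fun i => (g i \o f i)%VF) _.
Next Obligation.
move=> S W W' W'' g f i j x; rewrite comp_lfunE !sprep_hom_map.
congr (sprep_map _ _ _ _).
apply: (@tensor_linear_ext _ _ _ _ _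
  (tensor_map _ (g i) \o tensor_map _ (f i)) (tensor_map _ _)) => w m.
by rewrite /= !tensor_map_pure; congr pure; rewrite -[LHS]comp_lfunE.
Qed.

Program Definition sprep_category (S : species) : category :=
  @Category (sprep S) (@sprep_hom S) (@sprep_id S) (@sprep_comp S) _ _ _.
Next Obligation.
by move=> *; apply: sprep_hom_ext => i w; rewrite /= !(comp_lfunE, id_lfunE).
Qed.
Next Obligation.
by move=> *; apply: sprep_hom_ext => i w; rewrite /= !(comp_lfunE, id_lfunE).
Qed.
Next Obligation.
by move=> *; apply: sprep_hom_ext => i w; rewrite /= !comp_lfunE.
Qed.

Section QuiverSpecies.
Variables (K L : fieldType) (iota : {rmorphism K -> L}) (Q : ratquiver iota).

Definition edges_between (i j : orbits (vert Q)) : {set edge Q} :=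
  [set e | (src e \in val i) && (tgt e \in val j)]%SET.

(* The representatives v_i, e_o and the elements sigma_o, tau_o on which the
   species depends. *)
Record species_data := SpeciesData {
  vrep : orbits (vert Q) -> vert Q;
  erep : orbits (edge Q) -> edge Q;
  srep : orbits (edge Q) -> gal iota;
  trep : orbits (edge Q) -> gal iota;
  vrepP : forall i, vrep i \in val i;
  erepP : forall o, erep o \in val o;
  srepP : forall i j (o : orbits (edge Q)), val o \subset edges_between i j ->
    src (erep o) = act (srep o) (vrep i);
  trepP : forall i j (o : orbits (edge Q)), val o \subset edges_between i j ->
    tgt (erep o) = act (trep o) (vrep j) }.

Variable D : species_data.

Definition orbits_between (i j : orbits (vert Q)) : finType :=
  {o : orbits (edge Q) | val o \subset edges_between i j}.

Lemma srep_stab i j (o : orbits_between i j) :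
  stab (erep D (val o)) `<=` stab (act (srep D (val o)) (vrep D i)).
Proof.
by move=> s es; rewrite /stab /= -(srepP D (valP o)) -src_act [act s _]es.
Qed.

Lemma trep_stab i j (o : orbits_between i j) :
  stab (erep D (val o)) `<=` stab (act (trep D (val o)) (vrep D j)).
Proof.
by move=> s es; rewrite /stab /= -(trepP D (valP o)) -tgt_act [act s _]es.
Qed.

Definition edge_bimodule i j (o : orbits_between i j) :
    bimodule (fixfield (stab (vrep D i))) (fixfield (stab (vrep D j))) :=
  bimodule_of (fixmap (stab_conj (@srep_stab i j o)))
              (fixmap (stab_conj (@trep_stab i j o))).

(* L_i = L(v_i), and iMj is the sum of the L(e_o) over G \ E_ij. *)
Definition quiver_species : species :=
  @Species (orbits (vert Q)) (fun i => fixfield (stab (vrep D i)))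
    (fun i j => bimodule_sum (@edge_bimodule i j)).

End QuiverSpecies.

(* Main.v *)
From HB Require Import structures.
From mathcomp Require Import all_boot all_algebra all_field.
From mathcomp Require Import boolp classical_sets topology.
Require Import Defs.

(** Galois descent, used once for vertices and once for edges, gives the
equivalence.

Write G_x for the stabilizer of a vertex or edge x and L(x) for its fixed
field. Each space M(v) of a rational representation carries a continuous
semilinear action of G_v, so it has an L-basis of G_v-invariant vectors
([galois_descent]) and is L tensored with M(v)^(G_v) over L(v).  The spaces W_i
= M(v_i)^(G_(v_i)) therefore determine all of M up to transport along G.

For the edges, let X be the set of edges that start in the orbit i and end at
v_j.  The group G_(v_j) acts on X, its orbits correspond to the G-orbits
between i and j, and an element x of the bimodule iMj spreads to the function e
|-> x_e on X that is equal to s(x_o) at e = s e_o.  In this way iMj becomes the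
space of G_(v_j)-invariants of L^X ([spread], [spread_surj], [spread_ext]).
Accordingly the map f_ij attached to the arrows phi_e is the restriction to
invariants of the sum of the phi_e,

    f_ij (w (x) x) = sum over e in X of x_e phi_e (w transported to src e).

Descent for L^X shows that f_ij determines the phi_e ([spread_separates]) and
that every L_j-linear map on iMj arises from arrows ([trace_duality]).  This is
the duality Hom_(L_j)(L(e), L_j) = L(e) given by the trace form, in a version
where the conjugates of e are summed over as edges.

Descent itself is Dedekind's independence argument.  As L / K is algebraic, a
vector m has finitely many translates; the sums of s(a) (s m) over these
translates are invariant for all suitable scalars a, and the independence of
the automorphisms s modulo the span of the invariants puts m into that span
([dedekind_mod], [trace_invariant]).

Instead of composing two functors that both depend on choices of bases, the
proof compares representations of the quiver with representations of the
species through a relation: a [link] from M to W is a family of bijections of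
W_i with the invariants of M(v_i) for which the formula above holds.  Every
object has a link on either side ([link_species], [link_matrix_rep]), and
morphisms correspond uniquely along links ([related_lift1], [related_lift2]);
this is an equivalence of categories ([equivalence_of_correspondence]). *)

Set Implicit Arguments.
Unset Strict Implicit.
Unset Printing Implicit Defensive.

Import GRing.Theory.

Local Open Scope classical_set_scope.
Local Open Scope ring_scope.

(** * Equivalences of categories from correspondences *)

Section Correspondence.
Variables (C D : category) (link : C -> D -> Type).
Variable related : forall X A, link X A -> forall Y B, link Y B ->
  hom X Y -> hom A B -> Prop.
Hypothesis related_id : forall X A (l : link X A), related l l (idm X) (idm A).
Hypothesis related_comp : forall X A (l : link X A) Y B (l' : link Y B)
    Z E (l'' : link Z E) f f' g g',
  related l l' f f' -> related l' l'' g g' ->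
  related l l'' (compm g f) (compm g' f').
Hypothesis link_obj1 : forall X, exists A, inhabited (link X A).
Hypothesis link_obj2 : forall A, exists X, inhabited (link X A).
Hypothesis lift1 : forall X A (l : link X A) Y B (l' : link Y B) f,
  exists! f', related l l' f f'.
Hypothesis lift2 : forall X A (l : link X A) Y B (l' : link Y B) f',
  exists! f, related l l' f f'.

Arguments related_id {X A} l.
Arguments related_comp {X A l Y B l' Z E l'' f f' g g'}.

(** Choosing for each object a linked one gives functors F and G.  The objects
G (F X) and X are both linked to F X, so the identity of F X lifts to an
isomorphism between them; the required equations hold because lifts are
unique. *)
Lemma equivalence_of_correspondence : equivalent_categories C D.
Proof.
have sF X : {A : D & link X A}.
  by have [A /inhabited_witness l] := cid (link_obj1 X); exists A.
have sG A : {X : C & link X A}.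
  by have [X /inhabited_witness l] := cid (link_obj2 A); exists X.
have s1 X A (l : link X A) Y B (l' : link Y B) f : {f' | related l l' f f'}.
  by apply: cid; have [f' [? _]] := lift1 l l' f; exists f'.
have s2 X A (l : link X A) Y B (l' : link Y B) f' : {f | related l l' f f'}.
  by apply: cid; have [f [? _]] := lift2 l l' f'; exists f.
have u1 X A (l : link X A) Y B (l' : link Y B) f f' f'' :
    related l l' f f' -> related l l' f f'' -> f' = f''.
  by have [g [_ ug]] := lift1 l l' f; move=> /ug <- /ug <-.
have u2 X A (l : link X A) Y B (l' : link Y B) f' f f'' :
    related l l' f f' -> related l l' f'' f' -> f = f''.
  by have [g [_ ug]] := lift2 l l' f'; move=> /ug <- /ug <-.
pose lF X := projT2 (sF X); pose lG A := projT2 (sG A).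
pose mF X Y (f : hom X Y) := sval (s1 _ _ (lF X) _ _ (lF Y) f).
pose mG A B (f : hom A B) := sval (s2 _ _ (lG A) _ _ (lG B) f).
have rF X Y (f : hom X Y) : related (lF X) (lF Y) f (mF X Y f).
  exact: (svalP (s1 _ _ _ _ _ _ _)).
have rG A B (f : hom A B) : related (lG A) (lG B) (mG A B f) f.
  exact: (svalP (s2 _ _ _ _ _ _ _)).
have F1 X : mF _ _ (idm X) = idm _ by apply: u1 (rF _ _ _) (related_id _).
have FM X Y Z (g : hom Y Z) (f : hom X Y) :
    mF _ _ (compm g f) = compm (mF _ _ g) (mF _ _ f).
  by apply: u1 (rF _ _ _) (related_comp (rF _ _ _) (rF _ _ _)).
have G1 X : mG _ _ (idm X) = idm _ by apply: u2 (rG _ _ _) (related_id _).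
have GM X Y Z (g : hom Y Z) (f : hom X Y) :
    mG _ _ (compm g f) = compm (mG _ _ g) (mG _ _ f).
  by apply: u2 (rG _ _ _) (related_comp (rG _ _ _) (rG _ _ _)).
pose F := @Functor C D _ mF F1 FM; pose G := @Functor D C _ mG G1 GM.
exists F, G; split; constructor.
  have a X := s2 _ _ (lG (F X)) _ _ (lF X) (idm (F X)).
  have b X := s2 _ _ (lF X) _ _ (lG (F X)) (idm (F X)).
  have ab X := related_comp (svalP (a X)) (svalP (b X)).
  have ba X := related_comp (svalP (b X)) (svalP (a X)).
  apply: (@NatIso C C (functor_comp G F) (functor_id C)
    (fun X => sval (a X)) (fun X => sval (b X))).
  - move=> X; apply: (u2 _ _ (lG (F X)) _ _ _ (idm _)); last exact: related_id.
    by have := ab X; rewrite comp1m.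
  - move=> X; apply: (u2 _ _ (lF X) _ _ _ (idm _)); last exact: related_id.
    by have := ba X; rewrite comp1m.
  - move=> X Y f.
    have := related_comp (svalP (a X)) (rF _ _ f); rewrite compm1 => af.
    have := related_comp (rG _ _ (mF _ _ f)) (svalP (a Y)); rewrite comp1m => fa.
    exact: u2 af fa.
have a A := s1 _ _ (lF (G A)) _ _ (lG A) (idm (G A)).
have b A := s1 _ _ (lG A) _ _ (lF (G A)) (idm (G A)).
have ab A := related_comp (svalP (a A)) (svalP (b A)).
have ba A := related_comp (svalP (b A)) (svalP (a A)).
apply: (@NatIso D D (functor_comp F G) (functor_id D)
  (fun A => sval (a A)) (fun A => sval (b A))).
- move=> A; apply: (u1 _ _ (lF (G A)) _ _ _ (idm _)); last exact: related_id.
  by have := ab A; rewrite comp1m.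
- move=> A; apply: (u1 _ _ (lG A) _ _ _ (idm _)); last exact: related_id.
  by have := ba A; rewrite comp1m.
- move=> A B f.
  have := related_comp (svalP (a A)) (rG _ _ f); rewrite compm1 => af.
  have := related_comp (rF _ _ (mG _ _ f)) (svalP (a B)); rewrite comp1m => fa.
  exact: u1 af fa.
Qed.

End Correspondence.

(** * Galois descent *)

Lemma finitely_many_roots (F : fieldType) (p : {poly F}) :
  p != 0 -> exists rs : seq F, forall x, root p x -> x \in rs.
Proof.
have [n] := ubnP (size p); elim: n p => // n IHn p /ltnSE le_p_n p_neq0.
have [[x]|no_root] := pselect (exists x, root p x); last first.
  by exists [::] => x px; case: no_root; exists x.
move=> /factor_theorem[q def_p].
have q_neq0 : q != 0 by apply: contraNneq p_neq0 => q0; rewrite def_p q0 mul0r.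
have [|//|rs rsP] := IHn q.
  apply: leq_trans le_p_n; rewrite def_p size_Mmonic ?monicXsubC //.
  by rewrite size_XsubC addn2.
exists (x :: rs) => y; rewrite def_p rootM root_XsubC in_cons orbC.
by case/orP=> [->//|/rsP ->]; rewrite orbT.
Qed.

(** The predicate P need not be decidable or finite: a free family in P that is
contained in no longer one exists because the dimension bounds its size. *)
Lemma span_of_pred (F : fieldType) (V : vectType F) (P : V -> Prop) :
  exists X : seq V, [/\ free X, {in X, forall v, P v}
                      & forall v, P v -> v \in <<X>>%VS].
Proof.
suff ind n X : free X -> {in X, forall v, P v} ->
    (\dim {:V} <= size X + n)%N ->
    exists X : seq V, [/\ free X, {in X, forall v, P v}
                        & forall v, P v -> v \in <<X>>%VS].
  by apply: (ind (\dim {:V}) [::]) => //; exact: nil_free.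
elim: n X => [|n IHn] X frX PX leX.
  exists X; split=> // v _; have /andP[/eqP-> _] : basis_of {:V} X.
    by rewrite basisEfree frX subvf -[size X]addn0 leX.
  exact: memvf.
have [[v [Pv vX]]|nX] := pselect (exists v, P v /\ v \notin <<X>>%VS).
  apply: (IHn (v :: X)); rewrite ?free_cons ?vX //=; last by rewrite addSnnS.
  by move=> w; rewrite in_cons => /predU1P[->|/PX].
by exists X; split=> // v Pv; apply/negP => /negP vX; case: nX; exists v.
Qed.

Lemma uniq_map_inj (T1 T2 : eqType) (f : T1 -> T2) (s : seq T1) :
  uniq (map f s) -> {in s &, injective f}.
Proof.
move=> fs x y xs ys fxy; rewrite -(nth_index x xs) -(nth_index x ys).
congr nth; apply/eqP; rewrite -(nth_uniq (f x) _ _ fs) ?size_map ?index_mem //.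
by rewrite !(nth_map x) ?index_mem // !nth_index // fxy.
Qed.

Section Descent.
Variables (K L : fieldType) (iota : {rmorphism K -> L}).
Local Notation gal := (gal iota).

Definition subgroup (H : set gal) : Prop :=
  [/\ H 1%g, forall s t, H s -> H t -> H (s * t)%g
    & forall s, H s -> H s^-1%g].

(** The action is a function on the whole group that matters on H only, so that
it can be summed over lists of automorphisms.  The last field is continuity:
the pointwise stabilizers of finite subsets of L are a basis of
neighbourhoods of 1. *)
Record semilinear_action (H : set gal) (V : vectType L) (rho : gal -> V -> V)
    : Prop := SemilinearAction {
  actionD : forall s m n, H s -> rho s (m + n) = rho s m + rho s n;
  actionZ : forall s a m, H s -> rho s (a *: m) = s a *: rho s m;
  action1 : forall m, rho 1%g m = m;
  actionM : forall s t m, H s -> H t -> rho (s * t)%g m = rho s (rho t m);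
  action_cont : forall m, exists r : seq L, forall s, H s ->
    {in r, s =1 id} -> rho s m = m }.

Definition invariant (H : set gal) (V : Type) (rho : gal -> V -> V) m :=
  forall s, H s -> rho s m = m.

Lemma action0 (H : set gal) (V : vectType L) (rho : gal -> V -> V)
    (rhoP : semilinear_action H rho) : invariant H rho 0.
Proof.
move=> s Hs; rewrite -[X in rho s X](scale0r (0 : V)) (actionZ rhoP) //.
by rewrite rmorph0 scale0r.
Qed.

Lemma action_sum (H : set gal) (V : vectType L) (rho : gal -> V -> V)
    (rhoP : semilinear_action H rho) s (I : Type) (r : seq I) (P : pred I)
    (a : I -> L) (F : I -> V) : H s ->
  rho s (\sum_(i <- r | P i) a i *: F i)
    = \sum_(i <- r | P i) s (a i) *: rho s (F i).
Proof.
move=> Hs; have rho0 := action0 rhoP Hs.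
have rhoD m n := actionD rhoP m n Hs.
rewrite (big_morph (rho s) rhoD rho0); apply: eq_bigr => i _.
exact: (actionZ rhoP (a i) (F i) Hs).
Qed.

Lemma galK (s : gal) x : (s^-1)%g (s x) = x.
Proof. by rewrite -[LHS]/((s^-1 * s)%g x) mulVg. Qed.

Lemma galVK (s : gal) x : s ((s^-1)%g x) = x.
Proof. by rewrite -[LHS]/((s * s^-1)%g x) mulgV. Qed.

(** An automorphism permutes the roots of a polynomial over K, so it has
finitely many possible values at each algebraic element. *)
Lemma finite_conjugates (algL : forall x, algebraicOver iota x) (r : seq L) :
  exists S : seq (seq L), forall s : gal, map s r \in S.
Proof.
elim: r => [|x r [S rS]]; first by exists [:: [::]] => s; rewrite inE.
have [p p_neq0 px] := algL x.
have [|rs rsP] := @finitely_many_roots _ (map_poly iota p).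
  by rewrite map_poly_eq0.
exists [seq y :: l | y <- rs, l <- S] => s /=.
apply/allpairsP; exists (s x, map s r); split=> //=; apply: rsP.
have -> : map_poly iota p = map_poly s (map_poly iota p).
  by rewrite -map_poly_comp; apply: eq_map_poly => a /=; rewrite gal_fix.
by rewrite fmorph_root.
Qed.

(** R represents the cosets in H of the open subgroup that fixes r pointwise;
two automorphisms lie in the same coset exactly when they agree on r. *)
Lemma coset_representatives (algL : forall x, algebraicOver iota x)
    (H : set gal) (r : seq L) :
  exists R : seq gal, [/\ {in R, forall t : gal, H t},
    uniq [seq map (gal_fun t) r | t <- R]
    & forall s, H s -> exists2 t, t \in R & {in r, t =1 s}].
Proof.
have [S rS] := finite_conjugates algL r.
suff [R [RH Ru RP]] : exists R : seq gal, [/\ {in R, forall t : gal, H t},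
    uniq [seq map (gal_fun t) r | t <- R]
    & forall s, H s -> map s r \in S -> exists2 t, t \in R & {in r, t =1 s}].
  by exists R; split=> // s Hs; apply: RP.
elim: {rS}S => [|y S [R [RH Ru RP]]]; first by exists [::].
have [[s [Hs sy nR]]|noS] := pselect (exists s : gal, [/\ H s, map s r = y &
    y \notin [seq map (gal_fun t) r | t <- R]]).
  exists (s :: R); split=> [t||t Ht].
  - by rewrite in_cons => /predU1P[->|/RH].
  - by rewrite /= sy nR.
  rewrite in_cons => /predU1P[ty|/(RP _ Ht)[u uR ut]]; last first.
    by exists u; rewrite // in_cons uR orbT.
  exists s; first exact: mem_head.
  by apply/eq_in_map; rewrite sy ty.
exists R; split=> // s Hs; rewrite in_cons => /predU1P[sy|]; last exact: RP.
have: y \in [seq map (gal_fun t) r | t <- R].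
  by apply/negP => /negP yR; apply: noS; exists s.
by case/mapP=> t tR yt; exists t => //; apply/eq_in_map; rewrite -yt sy.
Qed.

(** Dedekind's proof that distinct characters are independent: subtract s b
times the relation at a from the relation at a * b, which removes the term of
s, and use induction.  Working modulo a subspace N makes the vectors n t the
coefficients. *)
Lemma dedekind_mod (V : vectType L) (N : {vspace V}) (A : L -> Prop)
    (R : seq gal) (n : gal -> V) :
  A 1 -> (forall a b, A a -> A b -> A (a * b)) -> uniq R ->
  {in R &, forall s t : gal, s != t -> exists2 a, A a & s a != t a} ->
  (forall a, A a -> \sum_(t <- R) t a *: n t \in N) ->
  {in R, forall t, n t \in N}.
Proof.
move=> A1 AM; elim: R n => [//|s R IHR] n /= /andP[sR Ru] sep sumN.
have sep' : {in R &, forall s t : gal, s != t -> exists2 a, A a & s a != t a}.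
  by move=> t u tR uR; apply: (sep t u); rewrite in_cons (tR, uR) orbT.
have nR : {in R, forall t, n t \in N}.
  move=> t tR; have ts : t != s by apply: contraNneq sR => <-.
  have tR' : t \in s :: R by rewrite in_cons tR orbT.
  have [b Ab sb] := sep t s tR' (mem_head _ _) ts.
  have tsb : t b - s b != 0 by rewrite subr_eq0.
  rewrite -[n t](scalerK tsb); apply: memvZ.
  apply: (IHR (fun u => (u b - s b) *: n u) Ru sep' _ t tR) => a Aa.
  have := memvB (sumN _ (AM _ _ Aa Ab)) (memvZ (s b) (sumN a Aa)).
  rewrite !big_cons scalerDr scalerA [s b * _]mulrC -rmorphM opprD addrACA.
  rewrite subrr add0r scaler_sumr -sumrB.
  congr (_ \in N); apply: eq_bigr => u _.
  by rewrite rmorphM !scalerA -scalerBl mulrBr [s b * _]mulrC.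
move=> t; rewrite in_cons => /predU1P[->|/nR//].
have := sumN 1 A1; rewrite big_cons rmorph1 scale1r => sN.
rewrite -[n s](addrK (\sum_(u <- R) u 1 *: n u)); apply: memvB => //.
by rewrite big_seq; apply: memv_suml => u uR; rewrite memvZ // nR.
Qed.

(** An element of H permutes the cosets that the list R represents, and the
summand depends only on the coset of t. *)
Lemma trace_invariant (H : set gal) (gH : subgroup H) (V : vectType L)
    (rho : gal -> V -> V) (rhoP : semilinear_action H rho) (r : seq L)
    (R : seq gal) (a : L) (m : V) :
  {in R, forall t : gal, H t} -> uniq [seq map (gal_fun t) r | t <- R] ->
  (forall s, H s -> exists2 t, t \in R & {in r, t =1 s}) ->
  (forall u, H u -> {in r, u =1 id} -> rho u m = m) ->
  (forall u, H u -> {in r, u =1 id} -> u a = a) ->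
  invariant H rho (\sum_(t <- R) t a *: rho t m).
Proof.
have [H1 HM HV] := gH => RH Ru RP rm ra s Hs.
pose f (t : gal) := t a *: rho t m.
have -> : rho s (\sum_(t <- R) f t) = \sum_(t <- R) f (s * t)%g.
  rewrite (action_sum rhoP) // big_seq [RHS]big_seq.
  by apply: eq_bigr => t tR; rewrite -(actionM rhoP m Hs (RH t tR)).
have fE t u : H t -> H u -> {in r, t =1 u} -> f t = f u.
  move=> Ht Hu tu; have -> : t = (u * (u^-1 * t))%g by rewrite mulgA mulgV mul1g.
  have HV' : H (u^-1 * t)%g by apply: HM => //; apply: HV.
  have fx : {in r, (u^-1 * t)%g =1 id}.
    by move=> x xr /=; rewrite -[LHS]/((u^-1)%g (t x)) tu // galK.
  rewrite /f (actionM rhoP) // rm //; congr (_ *: _).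
  by rewrite -[LHS]/(u ((u^-1 * t)%g a)) ra.
(* p t is the representative of the coset of s * t *)
have /all_sig2[p pR ps] : forall t, {u | t \in R -> u \in R
    & t \in R -> {in r, u =1 (s * t)%g}}.
  move=> t; have [/RH Ht|tR] := boolP (t \in R); last by exists 1%g => // /negPf tR'.
  by have /cid2[u] := RP _ (HM _ _ Hs Ht); exists u.
have Ru' : uniq R by apply: map_uniq Ru.
have pu : uniq (map p R).
  rewrite map_inj_in_uniq // => t u tR uR ptu.
  apply: (uniq_map_inj Ru tR uR); apply/eq_in_map => x xr.
  apply: (can_inj (galK s)).
  by rewrite -[LHS]/((s * t)%g x) -[RHS]/((s * u)%g x) -!ps // ptu.
have pRR : {subset map p R <= R} by move=> _ /mapP[t tR ->]; apply: pR.
have [|_ pRE] := uniq_min_size pu pRR; first by rewrite size_map.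
rewrite -[RHS](perm_big _ (uniq_perm pu Ru' pRE)) /= big_map.
rewrite big_seq [RHS]big_seq; apply: eq_bigr => t tR; apply: fE.
- by apply: HM => //; apply: RH.
- exact/RH/pR.
- by move=> x xr; rewrite (ps _ tR).
Qed.

(** Take a maximal free family of invariant vectors.  The trace sums of any
vector m lie in its span, so [dedekind_mod] puts the translates of m, and m
among them, into this span. *)
Lemma galois_descent (algL : forall x, algebraicOver iota x) (H : set gal)
    (gH : subgroup H) (V : vectType L) (rho : gal -> V -> V)
    (rhoP : semilinear_action H rho) :
  exists X : seq V, basis_of fullv X /\ {in X, forall v, invariant H rho v}.
Proof.
have [X [frX invX maxX]] := span_of_pred (invariant H rho).
have [H1 HM HV] := gH.
exists X; split=> //; rewrite basisEfree frX subvf /=.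
suff -> : fullv = <<X>>%VS by rewrite (eqP frX).
apply/esym/eqP; rewrite eqEsubv subvf; apply/subvP => m _.
have [r rm] := action_cont rhoP m.
have [R [RH Ru RP]] := coset_representatives algL H r.
have [t tR t1] := RP _ H1.
rewrite -(rm t (RH t tR) t1).
(* the fixed field of the stabilizer of r contains r, hence separates R *)
pose A a := forall u : gal, H u -> {in r, u =1 id} -> u a = a.
apply: (dedekind_mod (A := A) (n := rho^~ m) _ _ (map_uniq Ru)) tR.
- by move=> u _ _; apply: rmorph1.
- by move=> a b Aa Ab u Hu ur; rewrite rmorphM Aa ?Ab.
- move=> u v uR vR uv; have [x xr ux] : exists2 x, x \in r & u x != v x.
    apply/hasP; apply: contraT; rewrite -all_predC => /allP uvr.
    case/eqP: uv; apply/(uniq_map_inj Ru uR vR)/eq_in_map => x.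
    by move=> /uvr /negPn /eqP.
  by exists x => // w _ wr; apply: wr.
- by move=> a Aa; apply: maxX; apply: (trace_invariant gH rhoP RH Ru RP).
Qed.

(** Applying an element of H to the expansion of v gives another expansion of v,
with conjugated coordinates. *)
Lemma coord_invariant (H : set gal) (V : vectType L) (rho : gal -> V -> V)
    (rhoP : semilinear_action H rho) n (X : n.-tuple V) v :
  basis_of fullv X -> {in X, forall v, invariant H rho v} ->
  invariant H rho v -> forall k, coord X k v \in fixed H.
Proof.
move=> bX invX invv k; apply/asboolP => s Hs.
have := invv s Hs; rewrite {1}(coord_basis bX (memvf v)).
have -> : rho s (\sum_i coord X i v *: X`_i) = \sum_i s (coord X i v) *: X`_i.
  rewrite (action_sum rhoP) //; apply: eq_bigr => i _.
  by rewrite invX // mem_nth // size_tuple.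
by move=> /(congr1 (coord X k)); rewrite coord_sum_free // (basis_free bX).
Qed.

(** The universal property of V as the extension of scalars of its invariants,
stated without a type of invariants: c is a total function of which only the
values at invariant vectors matter. *)
Lemma descent_extension (algL : forall x, algebraicOver iota x) (H : set gal)
    (gH : subgroup H) (V : vectType L) (rho : gal -> V -> V)
    (rhoP : semilinear_action H rho) (V' : lmodType L) (c : V -> V') :
  (forall a v w, a \in fixed H -> invariant H rho v -> invariant H rho w ->
    c (a *: v + w) = a *: c v + c w) ->
  exists C : {linear V -> V'}, forall v, invariant H rho v -> C v = c v.
Proof.
move=> cP; have [X0 [bX invX]] := galois_descent algL gH rhoP.
pose X := in_tuple X0.
pose C v := \sum_i coord X i v *: c X`_i.
have Clin : linear C.
  move=> a v w; rewrite /C scaler_sumr -big_split; apply: eq_bigr => i _ /=.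
  by rewrite linearP scalerDl scalerA.
pose lC := GRing.isLinear.Build L V V' *:%R C Clin.
pose C' : {linear V -> V'} := HB.pack C lC.
exists C' => v invv; rewrite /= /C {2}(coord_basis (X := X) bX (memvf v)).
have inv0 := action0 rhoP.
have fx := coord_invariant (X := X) rhoP bX invX invv.
have iX (i : 'I_(size X0)) : invariant H rho X`_i.
  exact: (invX _ (mem_nth 0 (ltn_ord i))).
have c0 : c 0 = 0.
  have := cP 1 0 0 (rpred1 _) inv0 inv0.
  by rewrite !scale1r addr0 => /eqP; rewrite -subr_eq subrr eq_sym => /eqP.
suff : invariant H rho (\sum_i coord X i v *: X`_i) /\
  \sum_i coord X i v *: c X`_i = c (\sum_i coord X i v *: X`_i) by case.
elim: (index_enum _) => [|i r [inv_r IHr]]; first by rewrite !big_nil.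
rewrite !big_cons IHr cP //; split=> // s Hs.
rewrite (actionD rhoP) // (actionZ rhoP) // iX // inv_r //.
by have /asboolP -> := fx i.
Qed.

End Descent.

(** * Finite sets with a continuous Galois action *)

Section GaloisSets.
Variables (K L : fieldType) (iota : {rmorphism K -> L}) (X : galset iota).
Local Notation gal := (gal iota).

Lemma act_inj (s : gal) : injective (act s : X -> X).
Proof. by move=> x y /(congr1 (act s^-1%g)); rewrite -!actM mulVg !act1. Qed.

Lemma actK (s : gal) (x : X) : act s^-1%g (act s x) = x.
Proof. by rewrite -actM mulVg act1. Qed.

Lemma actVK (s : gal) (x : X) : act s (act s^-1%g x) = x.
Proof. by rewrite -actM mulgV act1. Qed.

Lemma act_locally_constant (s : gal) (x : X) :
  exists r : seq L, forall t : gal, {in r, t =1 s} -> act t x = act s x.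
Proof.
have xP : open [set act s x : discrete_topology X].
  exact: discrete_open.
have := @act_continuous _ _ _ X (s, x) _ (open_nbhs_nbhs (conj xP erefl)).
case=> [[A B] /= [sA xB] AB].
move: sA; rewrite nbhsE => -[U [oU Us] UA].
have [r rU] := oU s Us; exists r => t /rU /UA At.
exact: (AB (t, x) (conj At (nbhs_singleton xB))).
Qed.

Lemma stab_subgroup (x : X) : subgroup (stab x).
Proof.
rewrite /stab; split=> [|s t /= sx tx|s /= sx] /=; first exact: act1.
  by rewrite actM tx sx.
by rewrite -{1}sx actK.
Qed.

Lemma mem_orbitP (x y : X) : (y \in gal_orbit x) <-> exists s, act s x = y.
Proof.
rewrite inE; split=> [/asboolP[s ->]|[s <-]]; first by exists s.
by apply/asboolP; exists s.
Qed.

Lemma orbit_proof (x : X) : [exists y, gal_orbit x == gal_orbit y].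
Proof. by apply/existsP; exists x. Qed.

Definition orbit_of (x : X) : orbits X := exist _ (gal_orbit x) (orbit_proof x).

Lemma mem_orbit_of (x : X) : x \in val (orbit_of x).
Proof. by apply/mem_orbitP; exists 1%g; rewrite act1. Qed.

Lemma orbit_trans (o : orbits X) (x y : X) :
  x \in val o -> (y \in val o) <-> exists s, act s x = y.
Proof.
case: o => A /= /existsP[z /eqP->] /mem_orbitP[t <-]; rewrite mem_orbitP.
split=> [[s <-]|[s <-]]; last by exists (s * t)%g; rewrite actM.
by exists (s * t^-1)%g; rewrite actM actK.
Qed.

Lemma orbit_act (o : orbits X) s (x : X) : x \in val o -> act s x \in val o.
Proof. by move=> xo; apply/(orbit_trans _ xo); exists s. Qed.

Lemma orbit_actE (o : orbits X) s (x : X) :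
  (act s x \in val o) = (x \in val o).
Proof.
by apply/idP/idP => [/(orbit_act s^-1%g)|/(orbit_act s)//]; rewrite actK.
Qed.

Lemma orbit_of_eq (o : orbits X) (x : X) : x \in val o -> orbit_of x = o.
Proof.
move=> xo; apply: val_inj; apply/setP => y; apply/idP/idP.
  by move=> /mem_orbitP /(orbit_trans _ xo).
by move=> /(orbit_trans _ xo) /mem_orbitP.
Qed.

(** If no automorphism moves x to y, then neither does the default value 1, and
the [transport] defined below vanishes; so uses of [carry] need no case
analysis. *)
Definition carry (x y : X) : gal := xget 1%g [set s | act s x = y].

Lemma carryP (x y : X) : (exists s : gal, act s x = y) -> act (carry x y) x = y.
Proof. by case=> s sx; exact: (xgetI 1%g (P := [set s | act s x = y]) sx). Qed.

Lemma carry_orbit (o : orbits X) (x y : X) :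
  x \in val o -> y \in val o -> act (carry x y) x = y.
Proof. by move=> xo yo; apply/carryP/(orbit_trans _ xo). Qed.

(** An element of L(x) has a well-defined conjugate at every point of the orbit
of x. *)
Lemma fixed_stabE (x : X) (a : fixfield (stab x)) (s t : gal) :
  act s x = act t x -> s (fixval a) = t (fixval a).
Proof.
move=> st; have /asboolP/(_ (t^-1 * s)%g) := fixvalP a.
rewrite /stab /= actM st actK => /(_ erefl) {2}<-.
by rewrite -[RHS]/(t (t^-1%g (s (fixval a)))) galVK.
Qed.

End GaloisSets.

(** * The bimodules as invariant functions on edges *)

Section EdgeFunctions.
Variables (K L : fieldType) (iota : {rmorphism K -> L}).
Variables (Q : ratquiver iota) (D : species_data Q).
Local Notation gal := (gal iota).
Local Notation bimod i j := (sp_bimod (s := quiver_species D) i j).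
Local Notation edge_fun := {ffun edge Q -> L^o}.

Definition component i j (x : bimod i j) (o : orbits_between i j) :
    fixfield (stab (erep D (val o))) :=
  (x : dsum (@edge_bimodule _ _ _ Q D i j)) o.

(** The orbit component x_o of x is an element of L(e_o), and its conjugate
s(x_o) depends only on the edge s e_o.  The values are kept on the edges ending
at v_j only, where they form a G_(v_j)-invariant function; outside the set X of
edges from the orbit i to v_j the function is zero. *)
Definition spread i j (x : bimod i j) : edge_fun :=
  [ffun e => if tgt e == vrep D j then
     \sum_(o : orbits_between i j | e \in val (val o))
        carry (erep D (val o)) e (fixval (component x o))
   else 0].

Lemma edge_orbit (i j : orbits (vert Q)) (e : edge Q) :
  src e \in val i -> tgt e \in val j ->
  exists o : orbits_between i j, e \in val (val o).
Proof.
move=> ei ej.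
have sub : val (orbit_of e) \subset edges_between i j.
  apply/fintype.subsetP => e' /mem_orbitP[s <-].
  by rewrite inE src_act tgt_act !orbit_actE ei ej.
by exists (exist _ (orbit_of e) sub); apply: mem_orbit_of.
Qed.

Lemma spreadE i j (x : bimod i j) (o : orbits_between i j) s e :
  tgt e = vrep D j -> act s (erep D (val o)) = e ->
  spread x e = s (fixval (component x o)).
Proof.
move=> tj se; rewrite ffunE tj eqxx.
have eo : e \in val (val o) by rewrite -se orbit_actE erepP.
rewrite (big_pred1 o) => [|o' /=].
  apply: (fixed_stabE (component x o)); rewrite se.
  by apply: carry_orbit eo; apply: erepP.
apply/idP/eqP => [eo'|->//]; apply: val_inj.
exact: etrans (esym (orbit_of_eq eo')) (orbit_of_eq eo).
Qed.

Lemma spread_tgt i j (x : bimod i j) e :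
  tgt e != vrep D j -> spread x e = 0.
Proof. by move=> /negPf tj; rewrite ffunE tj. Qed.

Lemma spread_src i j (x : bimod i j) e :
  src e \notin val i -> spread x e = 0.
Proof.
move=> ei; rewrite ffunE; case: eqP => // _; rewrite big1 // => o eo.
case/negP: ei; have /fintype.subsetP/(_ _ eo) := valP o.
by rewrite inE => /andP[].
Qed.

Variant edge_spec (i j : orbits (vert Q)) (e : edge Q) : Prop :=
| EdgeIn o s of tgt e = vrep D j & src e \in val i &
    act s (erep D (val (o : orbits_between i j))) = e
| EdgeOut of ~~ ((tgt e == vrep D j) && (src e \in val i)) &
    forall x : bimod i j, spread x e = 0.

Lemma edgeP (i j : orbits (vert Q)) e : edge_spec i j e.
Proof.
have [ei|ei] := boolP (src e \in val i); last first.
  by right=> [|x]; [rewrite (negPf ei) andbF | apply: spread_src].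
have [ej|ej] := eqVneq (tgt e) (vrep D j); last first.
  by right=> [|x]; [rewrite (negPf ej) | apply: spread_tgt].
have [|o eo] := edge_orbit ei (j := j); first by rewrite ej vrepP.
have /(orbit_trans _ (erepP D (val o)))[s se] := eo.
exact: EdgeIn se.
Qed.

Lemma spreadD i j (x y : bimod i j) e :
  spread (x + y) e = spread x e + spread y e.
Proof.
have [o s ej _ se|_ e0] := edgeP i j e; last by rewrite !e0 addr0.
by rewrite !(spreadE _ ej se) -rmorphD.
Qed.

(** L_j acts on L(e_o) through tau_o.  As e = s e_o ends at v_j, the product
s tau_o fixes v_j and hence acts trivially on L_j. *)
Lemma spread_ract i j (x : bimod i j) b e :
  spread (ract x b) e = fixval b * spread x e.
Proof.
have [o s ej _ se|_ e0] := edgeP i j e; last by rewrite !e0 mulr0.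
rewrite !(spreadE _ ej se) /= rmorphM mulrC; congr (_ * _).
rewrite -[LHS]/((s * trep D (val o))%g (fixval b)).
rewrite (fixed_stabE b (t := 1%g)) // act1 actM -(trepP D (valP o)) -tgt_act se.
exact: ej.
Qed.

Lemma spread_lact i j (x : bimod i j) a r e : act r (vrep D i) = src e ->
  spread (lact a x) e = r (fixval a) * spread x e.
Proof.
move=> rE; have [o s ej _ se|_ e0] := edgeP i j e; last by rewrite !e0 mulr0.
rewrite !(spreadE _ ej se) /= rmorphM; congr (_ * _).
rewrite -[LHS]/((s * srep D (val o))%g (fixval a)).
by apply: (fixed_stabE a); rewrite actM -(srepP D (valP o)) -src_act se rE.
Qed.

Lemma spread_act i j (x : bimod i j) s e : stab (vrep D j) s ->
  spread x (act s e) = s (spread x e).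
Proof.
move=> sj; have [o t ej _ te|_ e0] := edgeP i j e.
  rewrite (spreadE x (s := (s * t)%g) (o := o)) ?(spreadE x ej te) //.
    by rewrite tgt_act ej.
  by rewrite actM te.
rewrite e0 rmorph0; have [o t ej ei te|_ -> //] := edgeP i j (act s e).
have sej : tgt e = vrep D j.
  apply: (act_inj (s := s)); rewrite -tgt_act ej.
  by rewrite /stab /= in sj.
have te' : act (s^-1 * t)%g (erep D (val o)) = e by rewrite actM te actK.
rewrite (spreadE x ej te) -[RHS](rmorph0 s) -(e0 x) (spreadE x sej te').
by rewrite -[RHS]/(s (s^-1%g (t (fixval (component x o))))) galVK.
Qed.

Lemma spread_inj i j (x y : bimod i j) : spread x =1 spread y -> x = y.
Proof.
move=> xy; apply: functional_extensionality_dep => o.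
pose s := (trep D (val o))^-1%g.
have sj : tgt (act s (erep D (val o))) = vrep D j.
  by rewrite tgt_act (trepP D (valP o)) actK.
have := xy (act s (erep D (val o))).
rewrite !(spreadE _ (o := o) (s := s)) // => /fmorph_inj h.
exact: val_inj.
Qed.

(** The component at o is read off at the edge tau_o^-1 e_o, which ends at v_j,
and brought back to e_o by tau_o. *)
Lemma spread_surj i j (F : edge Q -> L) :
  (forall s e, stab (vrep D j) s -> F (act s e) = s (F e)) ->
  exists x : bimod i j, forall e, tgt e = vrep D j -> src e \in val i ->
    spread x e = F e.
Proof.
move=> FP.
pose y (o : orbits_between i j) :=
  trep D (val o) (F (act (trep D (val o))^-1%g (erep D (val o)))).
have yP o : y o \in fixed (stab (erep D (val o))).
  apply/asboolP => s so; rewrite /y; set t := trep D _; set e := erep D _ in so *.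
  have te : tgt e = act t (vrep D j) by apply: trepP (valP o).
  have sj : stab (vrep D j) (t^-1 * s * t)%g.
    rewrite /stab /= !actM -te -tgt_act [act s e]so te.
    by rewrite actK.
  have := FP _ (act t^-1%g e) sj; rewrite !actM actVK [act s e]so => {2}->.
  by rewrite -[RHS]/(t (t^-1%g (s (t (F (act t^-1%g e)))))) galVK.
exists (fun o => FixField (yP o)) => e ej ei.
have [o s _ _ se|] := edgeP i j e; last by rewrite ej eqxx ei.
rewrite (spreadE _ ej se) /= /y; set t := trep D _.
have te : tgt (erep D (val o)) = act t (vrep D j) by apply: trepP (valP o).
rewrite -[LHS]/((s * t)%g (F _)) -FP -?actM; last first.
  by rewrite /stab /= actM -te -tgt_act se.
by rewrite -mulgA mulgV mulg1 se.
Qed.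

Definition edge_fun_act (s : gal) (F : edge_fun) : edge_fun :=
  [ffun e => s (F (act s^-1%g e))].

Lemma edge_fun_actP H : semilinear_action H edge_fun_act.
Proof.
split.
- by move=> s F G _; apply/ffunP => e; rewrite !ffunE rmorphD.
- by move=> s a F _; apply/ffunP => e; rewrite !ffunE rmorphM.
- by move=> F; apply/ffunP => e; rewrite ffunE invg1 act1.
- by move=> s t F _ _; apply/ffunP => e; rewrite !ffunE invgM actM.
move=> F.
have /choice[r rP] : forall e : edge Q, exists r : seq L,
    forall t : gal, {in r, t =1 (1%g : gal)} -> act t e = act (1%g : gal) e.
  by move=> e; apply: act_locally_constant.
exists (flatten [seq F e :: r e | e <- enum (edge Q)]) => s _ sr.
have se e : s (F e) = F e /\ act s e = e.
  have sub :
      {subset F e :: r e <= flatten [seq F e :: r e | e <- enum (edge Q)]}.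
    by move=> a ae; apply/flatten_mapP; exists e; rewrite ?mem_enum.
  split; first by apply/sr/sub/mem_head.
  rewrite -[RHS]act1; apply: rP => a ae.
  by apply/sr/sub; rewrite in_cons ae orbT.
by apply/ffunP => e; rewrite ffunE -{1}(se e).2 actK (se e).1.
Qed.

Lemma spread_invariant i j (x : bimod i j) :
  invariant (stab (vrep D j)) edge_fun_act (spread x).
Proof.
move=> s sj; apply/ffunP => e; rewrite ffunE.
have [_ _ sV] := stab_subgroup (vrep D j).
by rewrite spread_act ?galVK //; apply: sV.
Qed.

Lemma invariant_edge_fun j (F : edge_fun) :
  invariant (stab (vrep D j)) edge_fun_act F ->
  forall s e, stab (vrep D j) s -> F (act s e) = s (F e).
Proof. by move=> Finv s e /Finv {1}<-; rewrite ffunE actK. Qed.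

Definition unspread i j (F : edge_fun) : bimod i j :=
  xget 0 [set x | forall e, tgt e = vrep D j -> src e \in val i ->
    spread x e = F e].

Arguments unspread : clear implicits.

Lemma unspreadP (i j : orbits (vert Q)) (F : edge_fun) e :
  invariant (stab (vrep D j)) edge_fun_act F ->
  tgt e = vrep D j -> src e \in val i -> spread (unspread i j F) e = F e.
Proof.
move=> /invariant_edge_fun /spread_surj - /(_ i) hx.
exact: (xgetPex (0 : bimod i j) (P := [set x : bimod i j | forall e, _]) hx).
Qed.

Lemma spread_ext i j (x y : bimod i j) :
  (forall e, tgt e = vrep D j -> src e \in val i -> spread x e = spread y e) ->
  x = y.
Proof.
move=> xy; apply: spread_inj => e; have [o s ej ei _|_ e0] := edgeP i j e.
  exact: xy.
by rewrite !e0.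
Qed.

(** Transport c to the invariant functions on edges and extend it to an L-linear
functional C on all functions by descent; alpha e is the value of C at the
indicator function of e.  On invariant functions C takes values in L_j, which
makes C, and so alpha, equivariant. *)
Lemma trace_duality (algL : forall x, algebraicOver iota x) i j
    (c : bimod i j -> fixfield (stab (vrep D j))) :
  (forall x y, c (x + y) = c x + c y) ->
  (forall x b, c (ract x b) = b * c x) ->
  exists alpha : edge Q -> L,
    (forall s e, stab (vrep D j) s -> alpha (act s e) = s (alpha e)) /\
    (forall x, \sum_e spread x e * alpha e = fixval (c x)).
Proof.
move=> cD cZ; pose H := stab (vrep D j).
have gH : subgroup H := stab_subgroup _.
have [|C CP] := descent_extension algL gH (edge_fun_actP H) (V' := L^o)
  (c := fun F => fixval (c (unspread i j F))).
  move=> a F G aH Finv Ginv.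
  have -> : unspread i j (a *: F + G)
      = ract (unspread i j F) (FixField aH) + unspread i j G.
    apply: spread_ext => e ej ei.
    rewrite spreadD spread_ract !unspreadP //; first by rewrite !ffunE.
    move=> s Hs; rewrite (actionD (edge_fun_actP H)) //.
    rewrite (actionZ (edge_fun_actP H)) // Finv // Ginv //.
    by have /asboolP -> := aH.
  by rewrite cD cZ.
pose delta e : edge_fun := [ffun e' => (e == e')%:R].
have deltaP (F : edge_fun) : F = \sum_e F e *: delta e :> edge_fun.
  apply/ffunP => e; rewrite sum_ffunE (bigD1 e) //= big1 => [|e' /negPf ne].
    by rewrite !ffunE eqxx addr0 [_ *: _]mulr1.
  by rewrite !ffunE ne scaler0.
exists (fun e => C (delta e)); split=> [s e Hs|x].
  have C_act F : C (edge_fun_act s F) = s (C F).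
    have [X [bX Xinv]] := galois_descent algL gH (edge_fun_actP H).
    rewrite (coord_basis (X := in_tuple X) bX (memvf F)).
    rewrite (action_sum (edge_fun_actP H)) // !linear_sum rmorph_sum.
    apply: eq_bigr => k _; have kinv := Xinv _ (mem_nth 0 (ltn_ord k)).
    rewrite kinv // !linearZ /= rmorphM; congr (_ * _).
    rewrite CP //.
    by have /asboolP -> := fixvalP (c (unspread i j (in_tuple X)`_k)).
  rewrite -C_act; congr (C _); apply/ffunP => e'; rewrite !ffunE rmorph_nat.
  by rewrite -(inj_eq (act_inj (s := s^-1%g))) actK.
rewrite -[in RHS](_ : unspread i j (spread x) = x); last first.
  by apply: spread_ext => e ej ei; rewrite unspreadP //; apply: spread_invariant.
rewrite -[RHS]CP; last exact: spread_invariant.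
by rewrite {2}[spread x]deltaP linear_sum; apply: eq_bigr => e _; rewrite linearZ.
Qed.

(** The indicator function of e is an L-combination of invariant functions, and
these agree on X with functions spread x. *)
Lemma spread_separates (algL : forall x, algebraicOver iota x) i j
    (V : lmodType L) (d : edge Q -> V) :
  (forall x : bimod i j, \sum_e spread x e *: d e = 0) ->
  forall e, tgt e = vrep D j -> src e \in val i -> d e = 0.
Proof.
move=> d0 e ej ei; pose H := stab (vrep D j).
have gH : subgroup H := stab_subgroup _.
have [X0 [bX Xinv]] := galois_descent algL gH (edge_fun_actP H).
pose X := in_tuple X0.
pose good e' := (tgt e' == vrep D j) && (src e' \in val i).
pose delta : edge_fun := [ffun e' => (e == e')%:R].
have -> : d e = \sum_(e' | good e') delta e' *: d e'.
  rewrite (bigD1 e) /=; last by rewrite /good ej eqxx.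
  rewrite big1 => [|e' /andP[_ /negPf ne]].
    by rewrite ffunE eqxx scale1r addr0.
  by rewrite ffunE eq_sym ne scale0r.
rewrite (coord_basis (X := X) bX (memvf delta)).
under eq_bigr => e' _ do rewrite sum_ffunE scaler_suml.
rewrite exchange_big big1 //= => k _.
under eq_bigr => e' _ do rewrite ffunE -scalerA.
rewrite -scaler_sumr; apply/eqP; rewrite scaler_eq0; apply/orP; right.
have kinv := Xinv _ (mem_nth 0 (ltn_ord k)).
apply/eqP; rewrite -[RHS](d0 (unspread i j X`_k)) [RHS](bigID good) /=.
rewrite [X in _ = _ + X]big1 ?addr0 => [|e' ne].
  apply: eq_bigr => e' /andP[/eqP e'j e'i].
  by rewrite unspreadP.
by have [o s e'j e'i _|_ ->] := edgeP i j e'; rewrite ?scale0r //;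
  move: ne; rewrite /good e'j e'i eqxx.
Qed.

End EdgeFunctions.

(** * Transport in a rational representation *)

Section Transport.
Variables (K L : fieldType) (iota : {rmorphism K -> L}).
Variables (Q : ratquiver iota) (M : ratrep Q).
Local Notation gal := (gal iota).

(** The semilinear isomorphism of M v with M v' given by s, extended by zero to
the case where s does not move v to v'.  Being total in v', it carries no
equality proof in its type, so that compositions become equations between
automorphisms. *)
Definition transport (v v' : vert Q) (s : gal) (m : M v) : M v' :=
  match act s v =P v' with
  | ReflectT e => ecast w (M w) e (rep_act s m)
  | ReflectF _ => 0
  end.

Lemma transportE v s (m : M v) : transport (act s v) s m = rep_act s m.
Proof.
by rewrite /transport; case: eqP => // e; rewrite (eq_irrelevance e erefl).
Qed.

Lemma transport_cast v v' s (m : M v) (e : act s v = v') :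
  transport v' s m = ecast w (M w) e (rep_act s m).
Proof. by case: v' / e; apply: transportE. Qed.

Lemma transport_out v v' s (m : M v) : act s v != v' -> transport v' s m = 0.
Proof. by rewrite /transport; case: eqP. Qed.

Lemma transport_linear v v' s a (m n : M v) :
  transport v' s (a *: m + n) = s a *: transport v' s m + transport v' s n.
Proof.
have [e|ne] := eqVneq (act s v) v'; last by rewrite !transport_out // scaler0 addr0.
by case: v' / e; rewrite !transportE rep_act_add rep_act_semilinear.
Qed.

Lemma transportD v v' s (m n : M v) :
  transport v' s (m + n) = transport v' s m + transport v' s n.
Proof. by rewrite -[m]scale1r transport_linear rmorph1 !scale1r. Qed.

Lemma transport0 v v' s : transport v' s (0 : M v) = 0.
Proof. by apply: (addrI (transport v' s (0 : M v))); rewrite -transportD !addr0. Qed.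

Lemma transportZ v v' s a (m : M v) :
  transport v' s (a *: m) = s a *: transport v' s m.
Proof. by rewrite -[a *: m]addr0 transport_linear transport0 addr0. Qed.

Lemma transport_sum v v' s (I : Type) (r : seq I) (P : pred I) (a : I -> L)
    (F : I -> M v) :
  transport v' s (\sum_(i <- r | P i) a i *: F i)
    = \sum_(i <- r | P i) s (a i) *: transport v' s (F i).
Proof.
rewrite (big_morph _ (@transportD v v' s) (@transport0 v v' s)).
by apply: eq_bigr => i _; rewrite transportZ.
Qed.

Lemma transportM v v' v'' s t (m : M v) : act t v = v' ->
  transport v'' s (transport v' t m) = transport v'' (s * t)%g m.
Proof.
move=> e; case: v' / e.
have [e|ne] := eqVneq (act s (act t v)) v''; last first.
  by rewrite !transport_out // actM.
case: v'' / e; rewrite !transportE rep_actM.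
by rewrite (transport_cast _ (actM s t v)).
Qed.

(** By the composition law the transport by 1 is idempotent, and it is
injective. *)
Lemma transport1 v (m : M v) : transport v 1%g m = m.
Proof.
apply: (bij_inj (rep_act_bij M v 1%g)); rewrite -!transportE.
by rewrite (transportM (act (1%g : gal) v) _ _ (act1 v)) mulg1.
Qed.

Lemma transportK v v' s (m : M v) : act s v = v' ->
  transport v s^-1%g (transport v' s m) = m.
Proof. by move=> e; rewrite transportM // mulVg transport1. Qed.

Lemma transportVK v v' s (m : M v') : act s v = v' ->
  transport v' s (transport v s^-1%g m) = m.
Proof.
by move=> e; rewrite transportM ?mulgV ?transport1 // -e actK.
Qed.

Lemma rep_map_transport s (e e' : edge Q) (m : M (src e)) : act s e = e' ->
  rep_map M e' (transport (src e') s m) = transport (tgt e') s (rep_map M e m).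
Proof.
move=> ee; case: e' / ee.
rewrite (transport_cast _ (esym (src_act s e))) rep_map_act.
by rewrite (transport_cast _ (esym (tgt_act s e))).
Qed.

Lemma transport_action v : semilinear_action (stab v) (@transport v v).
Proof.
split.
- by move=> s m n _; apply: transportD.
- by move=> s a m _; apply: transportZ.
- exact: transport1.
- by move=> s t m _ tv; rewrite transportM.
move=> m; have mopen : gal_open _ := @rep_act_continuous _ _ _ _ M v m.
have [|r rP] := mopen 1%g.
  by exists (act1 v); rewrite -transport_cast transport1.
by exists r => s _ /rP[sv sm]; rewrite (transport_cast _ sv).
Qed.

Definition fixed_vec v (m : M v) := invariant (stab v) (@transport v v) m.

Lemma transport_fixed v v' s t (m : M v) : fixed_vec m ->
  act s v = v' -> act t v = v' -> transport v' s m = transport v' t m.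
Proof.
move=> mfix sv tv; have e : stab v (t^-1 * s)%g by rewrite /stab /= actM sv -tv actK.
by rewrite -{2}(mfix _ e) transportM // mulgA mulgV mul1g.
Qed.

End Transport.
Arguments transport {K L iota Q M v} v' s m.

(** * Links and the correspondence of morphisms *)

Section Links.
Variables (K L : fieldType) (iota : {rmorphism K -> L}).
Variables (Q : ratquiver iota) (D : species_data Q).
Local Notation gal := (gal iota).
Local Notation bimod i j := (sp_bimod (s := quiver_species D) i j).
Local Notation invfield v := (fixfield (stab (v : vert Q))).

Record descent_iso (M : ratrep Q) v (W : lmodType (invfield v))
    (lam : W -> M v) : Prop := DescentIso {
  descent_linear : forall a w w',
    lam (a *: w + w') = fixval a *: lam w + lam w';
  descent_inj : injective lam;
  descent_fixed : forall w, fixed_vec (lam w);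
  descent_surj : forall m, fixed_vec m -> exists w, lam w = m }.

Lemma descentD (M : ratrep Q) v (W : lmodType (invfield v))
    (lam : W -> M v) : descent_iso lam -> {morph lam : w w' / w + w'}.
Proof.
by move=> lamP w w'; rewrite -[w]scale1r (descent_linear lamP) !scale1r.
Qed.

Lemma descent0 (M : ratrep Q) v (W : lmodType (invfield v))
    (lam : W -> M v) : descent_iso lam -> lam 0 = 0.
Proof.
by move=> lamP; apply: (addrI (lam 0)); rewrite -(descentD lamP) !addr0.
Qed.

Lemma descentZ (M : ratrep Q) v (W : lmodType (invfield v))
    (lam : W -> M v) a w : descent_iso lam ->
  lam (a *: w) = fixval a *: lam w.
Proof.
move=> lamP; rewrite -[a *: w]addr0 (descent_linear lamP).
by rewrite (descent0 lamP) addr0.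
Qed.

Lemma descent_inv (M : ratrep Q) v (W : lmodType (invfield v)) (lam : W -> M v) :
  descent_iso lam ->
  exists lamV : M v -> W, (forall m, fixed_vec m -> lam (lamV m) = m) /\
    cancel lam lamV.
Proof.
move=> lamP; pose lamV m := xget 0 [set w | lam w = m].
have lamVK m : fixed_vec m -> lam (lamV m) = m.
  move=> /(descent_surj lamP)[w wm].
  exact: (xgetI 0 (P := [set w | lam w = m]) wm).
exists lamV; split=> // w; apply: (descent_inj lamP); apply: lamVK.
exact: descent_fixed.
Qed.

Section Arrow.
Variable M : ratrep Q.

(** The contribution of the edge e to the species: the invariant vector m at
v_i is moved to src e, sent through the map of e, and read in M(v_j).  Zero
values of [transport] make it vanish unless e goes from the orbit i to v_j, and
the transport by 1 replaces a cast along tgt e = v_j. *)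
Definition arrow i j (m : M (vrep D i)) (e : edge Q) : M (vrep D j) :=
  transport (vrep D j) 1%g
    (rep_map M e (transport (src e) (carry (vrep D i) (src e)) m)).

Lemma arrow_out i j (m : M (vrep D i)) e :
  ~~ ((tgt e == vrep D j) && (src e \in val i)) -> arrow j m e = 0.
Proof.
rewrite negb_and => /orP[ej|ei]; rewrite /arrow.
  by rewrite transport_out // act1.
rewrite [transport (src e) _ _]transport_out ?linear0 ?transport0 //.
by apply: contraNneq ei => <-; rewrite orbit_actE vrepP.
Qed.

Lemma arrowE i j (m : M (vrep D i)) e r : fixed_vec m ->
  act r (vrep D i) = src e ->
  arrow j m e = transport (vrep D j) 1%g (rep_map M e (transport (src e) r m)).
Proof.
move=> mfix rE; rewrite /arrow; congr (transport _ _ (rep_map _ _ _)).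
by apply: transport_fixed => //; apply: carryP; exists r.
Qed.

Lemma arrow_act i j (m : M (vrep D i)) s e : fixed_vec m ->
  stab (vrep D j) s -> transport (vrep D j) s (arrow j m e) = arrow j m (act s e).
Proof.
move=> mfix sj; have sj' : act s (vrep D j) = vrep D j := sj.
have [|eout] := boolP ((tgt e == vrep D j) && (src e \in val i));
  last first.
  rewrite !arrow_out ?transport0 // tgt_act src_act orbit_actE.
  apply: contra eout => /andP[/eqP ej ->]; rewrite andbT; apply/eqP.
  by apply: (act_inj (s := s)); rewrite ej sj'.
case/andP=> /eqP ej /(orbit_trans _ (vrepP D i))[r rE].
rewrite (arrowE _ mfix rE) (arrowE (r := (s * r)%g) _ mfix) ?actM ?rE ?src_act //.
rewrite -[transport (src (act s e)) _ m](transportM (v' := src e)) //.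
rewrite rep_map_transport // !transportM ?act1 ?tgt_act //.
by rewrite mul1g mulg1.
Qed.

Lemma arrowD i j (m n : M (vrep D i)) e :
  arrow j (m + n) e = arrow j m e + arrow j n e.
Proof. by rewrite /arrow transportD linearD transportD. Qed.

Lemma arrowZ i j a (m : M (vrep D i)) e :
  arrow j (a *: m) e = carry (vrep D i) (src e) a *: arrow j m e.
Proof. by rewrite /arrow transportZ linearZ transportZ. Qed.

Lemma arrow_sum_fixed i j (m : M (vrep D i)) (x : bimod i j) :
  fixed_vec m -> fixed_vec (\sum_e spread x e *: arrow j m e).
Proof.
move=> mfix s sj; rewrite transport_sum [RHS](reindex_inj (act_inj (s := s))).
by apply: eq_bigr => e _; rewrite spread_act // arrow_act.
Qed.

(** The scalar a reaches src e conjugated by an automorphism moving v_i to src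
e, which is how L_i acts on spread functions. *)
Lemma arrow_balanced i j a (m : M (vrep D i)) (x : bimod i j) :
  \sum_e spread x e *: arrow j (fixval a *: m) e
    = \sum_e spread (lact a x) e *: arrow j m e.
Proof.
apply: eq_bigr => e _; have [ei|ei] := boolP (src e \in val i); last first.
  by rewrite !spread_src // !scale0r.
have rE := carry_orbit (vrepP D i) ei.
by rewrite (spread_lact _ _ rE) arrowZ scalerA mulrC.
Qed.

End Arrow.

Lemma hom_transport (M N : ratrep Q) (u : ratrep_hom M N) v v' s (m : M v) :
  u v' (transport v' s m) = transport v' s (u v m).
Proof.
have [e|ne] := eqVneq (act s v) v'; last by rewrite !transport_out // linear0.
by case: v' / e; rewrite !transportE ratrep_hom_act.
Qed.

Lemma hom_arrow (M N : ratrep Q) (u : ratrep_hom M N) i j (m : M (vrep D i)) e :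
  u _ (arrow j m e) = arrow j (u _ m) e.
Proof. by rewrite /arrow hom_transport ratrep_hom_map hom_transport. Qed.

(** The invariants are given through a bijection with W_i instead of as a
subtype, so that both a space of invariants with a chosen basis and a given W_i
fit. *)
Record link (M : ratrep Q) (W : sprep (quiver_species D)) := Link {
  link_fun :> forall i, W i -> M (vrep D i);
  link_descent : forall i, descent_iso (@link_fun i);
  link_map : forall i j w (x : bimod i j),
    @link_fun j (sprep_map W i j (pure w x))
      = \sum_e spread x e *: arrow j (@link_fun i w) e }.

Arguments link_fun : clear implicits.
Arguments link_fun {M W} l i w.

Definition related M W (l : link M W) N W' (l' : link N W')
    (u : ratrep_hom M N) (u' : sprep_hom W W') : Prop :=
  forall i w, u _ (l i w) = l' i (u' i w).

Hypothesis algL : forall x : L, algebraicOver iota x.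

(** [descent_extension] with W in the place of the invariants. *)
Lemma descent_extend (M : ratrep Q) v (W : lmodType (invfield v))
    (lam : W -> M v) (V : lmodType L) (c : W -> V) : descent_iso lam ->
  (forall a w w', c (a *: w + w') = fixval a *: c w + c w') ->
  exists C : {linear M v -> V}, forall w, C (lam w) = c w.
Proof.
move=> lamP cP; have [lamV [lamVK lamK]] := descent_inv lamP.
have [|C CP] := descent_extension algL (stab_subgroup v) (transport_action M v)
  (c := c \o lamV).
  move=> a m n aH mfix nfix /=.
  have -> : a *: m + n = lam (FixField aH *: lamV m + lamV n).
    by rewrite (descent_linear lamP) !lamVK.
  by rewrite lamK cP.
by exists C => w; rewrite CP ?[(c \o lamV) _]/= ?lamK //; apply: descent_fixed.
Qed.

(** A morphism of representations maps invariants to invariants, and the formula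
for the maps of the species is natural. *)
Lemma related_lift1 M W (l : link M W) N W' (l' : link N W')
    (u : ratrep_hom M N) : exists! u', related l l' u u'.
Proof.
have lP i := link_descent l i; have lP' i := link_descent l' i.
have ufix i w : fixed_vec (u _ (l i w)).
  by move=> s sv; rewrite -hom_transport (descent_fixed (lP i)).
have /all_sig[f fP] i : {f : 'Hom(W i, W' i) |
    forall w, l' i (f w) = u _ (l i w)}.
  apply: cid; have [lV [lVK lK]] := descent_inv (lP' i).
  pose f w := lV (u _ (l i w)).
  have flin : linear f.
    move=> a w w'; apply: (descent_inj (lP' i)).
    rewrite (descent_linear (lP' i)) /f !lVK //.
    by rewrite (descent_linear (lP i)) linearP.
  pose lf := GRing.isLinear.Build _ _ _ *:%R f flin.
  pose f' : {linear W i -> W' i} := HB.pack f lf.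
  by exists (linfun f') => w; rewrite lfunE /= lVK.
have fM i j (x : tensor (W i) (bimod i j)) :
    f j (sprep_map W i j x) = sprep_map W' i j (tensor_map (bimod i j) (f i) x).
  apply: (@tensor_linear_ext _ _ _ _ _ (f j \o sprep_map W i j)
    (sprep_map W' i j \o tensor_map (bimod i j) (f i))) => w y /=.
  rewrite tensor_map_pure; apply: (descent_inj (lP' j)).
  rewrite fP !link_map linear_sum; apply: eq_bigr => e _.
  by rewrite linearZ /= hom_arrow fP.
exists (SpRepHom fM); split=> [i w|g gP]; first by rewrite -fP.
apply: sprep_hom_ext => i w; apply: (descent_inj (lP' i)).
by rewrite -gP -fP.
Qed.

(** Extend u' to an L-linear map at each v_i by descent and to all vertices by
transport; equivariance makes the result independent of the automorphism used.
That it commutes with the arrows is tested on edges ending at some v_j, where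
[spread_separates] recovers the arrows one by one from the maps of the species.
*)
Lemma related_lift2 M W (l : link M W) N W' (l' : link N W')
    (u' : sprep_hom W W') : exists! u, related l l' u u'.
Proof.
have lP i := link_descent l i; have lP' i := link_descent l' i.
have /all_sig[C CP] i : {C : {linear M (vrep D i) -> N (vrep D i)} |
    forall w, C (l i w) = l' i (u' i w)}.
  apply/cid/(descent_extend (lP i)) => a w w'.
  by rewrite linearP (descent_linear (lP' i)).
have C_act i s m : stab (vrep D i) s ->
    C i (transport _ s m) = transport _ s (C i m).
  move=> si.
  have [X [bX Xinv]] := galois_descent algL (stab_subgroup _)
    (transport_action M (vrep D i)).
  rewrite (coord_basis (X := in_tuple X) bX (memvf m)).
  rewrite transport_sum !linear_sum.
  under [in RHS]eq_bigr => k _ do rewrite linearZ.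
  rewrite transport_sum; apply: eq_bigr => k _; rewrite linearZ.
  have kinv := Xinv _ (mem_nth 0 (ltn_ord k)).
  rewrite kinv //; have [w <-] := descent_surj (lP i) kinv.
  by rewrite CP (descent_fixed (lP' i)).
pose f i v r (m : M v) := transport v r (C i (transport (vrep D i) r^-1%g m)).
(* C i commutes with the stabilizer, so r matters only through r v_i *)
have f_indep i v r r' m : act r (vrep D i) = v -> act r' (vrep D i) = v ->
    f i v r m = f i v r' m.
  move=> rv r'v; have sv : stab (vrep D i) (r^-1 * r')%g.
    by rewrite /stab /= actM r'v -rv actK.
  rewrite /f -{1}[m](transportVK (s := r') m r'v) transportM //.
  by rewrite C_act // transportM // mulgA mulgV mul1g.
pose g i v := carry (vrep D i) v.
have gP (i : orbits (vert Q)) v : v \in val i -> act (g i v) (vrep D i) = v.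
  by move=> vi; apply: carry_orbit vi; apply: vrepP.
have gO v : act (g (orbit_of v) v) (vrep D (orbit_of v)) = v.
  by apply/gP/mem_orbit_of.
have flin v : linear (f (orbit_of v) v (g (orbit_of v) v)).
  by move=> a m n; rewrite /f transport_linear linearP transport_linear galVK.
pose F v : {linear M v -> N v} :=
  HB.pack (f (orbit_of v) v (g (orbit_of v) v))
    (GRing.isLinear.Build _ _ _ *:%R _ (flin v)).
have F_act v v' s m : act s v = v' ->
    F v' (transport v' s m) = transport v' s (F v m).
  move=> sv; rewrite /= /f.
  have -> : orbit_of v' = orbit_of v.
    by apply: orbit_of_eq; rewrite -sv orbit_actE mem_orbit_of.
  set i := orbit_of v.
  have sg : act (s * g i v)%g (vrep D i) = v' by rewrite actM gO.
  have g'v : act (g i v') (vrep D i) = v' by apply: carryP; exists (s * g i v)%g.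
  rewrite -/(f i v' (g i v') _) (f_indep _ _ _ _ _ g'v sg) /f.
  rewrite transportM // invgM -mulgA mulVg mulg1.
  by rewrite transportM ?gO.
have F_link i w : F _ (l i w) = l' i (u' i w).
  rewrite /= /f; have -> : orbit_of (vrep D i) = i.
    by apply: orbit_of_eq; apply: vrepP.
  rewrite -/(f i _ _ _) (f_indep _ _ _ 1%g) ?act1 ?gP ?vrepP //.
  by rewrite /f invg1 !transport1 CP.
have F_uniq v i r (W0 : vectType L) (a b : {linear M v -> W0}) :
    act r (vrep D i) = v ->
    (forall w, a (transport v r (l i w)) = b (transport v r (l i w))) ->
    a =1 b.
  move=> rv ab m; rewrite -[m](transportVK m rv).
  have [X [bX Xinv]] := galois_descent algL (stab_subgroup _)
    (transport_action M (vrep D i)).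
  rewrite (coord_basis (X := in_tuple X) bX (memvf (transport _ r^-1%g m))).
  rewrite transport_sum !linear_sum; apply: eq_bigr => k _; rewrite !linearZ.
  have kinv := Xinv _ (mem_nth 0 (ltn_ord k)).
  by have [w <-] := descent_surj (lP i) kinv; rewrite ab.
have F_map0 (i j : orbits (vert Q)) w e : tgt e = vrep D j -> src e \in val i ->
    F _ (arrow j (l i w) e) = arrow j (F _ (l i w)) e.
  move=> ej ei; apply/eqP; rewrite -subr_eq0; apply/eqP.
  pose d e := F _ (arrow j (l i w) e) - arrow j (F _ (l i w)) e.
  apply: (spread_separates algL (d := d)) ej ei => x; rewrite /d.
  under eq_bigr => e' _ do rewrite scalerBr -linearZ.
  rewrite sumrB -linear_sum -link_map [X in X - _]F_link [F _ (l i w)]F_link.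
  by rewrite -link_map sprep_hom_map tensor_map_pure subrr.
have F_map1 (j : orbits (vert Q)) e m : tgt e = vrep D j ->
    F _ (rep_map M e m) = rep_map N e (F _ m).
  move=> ej; pose i := orbit_of (src e); have ei := mem_orbit_of (src e).
  apply: (F_uniq _ i (g i (src e)) _ (F (tgt e) \o rep_map M e)
    (rep_map N e \o F (src e))) => [|w]; first exact: gP.
  have e1 : act 1%g (tgt e) = vrep D j by rewrite act1.
  have := F_map0 i j w e ej ei.
  rewrite (arrowE _ _ (gP i _ ei)); last exact: (descent_fixed (lP i)).
  rewrite (arrowE _ _ (gP i _ ei)); last first.
    by rewrite F_link; exact: (descent_fixed (lP' i)).
  rewrite (F_act _ _ _ _ e1) => /(congr1 (transport (tgt e) 1^-1%g)).
  by rewrite !(transportK _ e1) /= -(F_act _ _ _ _ (gP i _ ei)).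
have F_map e m : F _ (rep_map M e m) = rep_map N e (F _ m).
  pose j := orbit_of (tgt e); pose s := g j (tgt e).
  have e1e : act s (act s^-1%g e) = e by rewrite actVK.
  have e1j : tgt (act s^-1%g e) = vrep D j.
    by apply: (act_inj (s := s)); rewrite -tgt_act e1e gO.
  have s_src : act s (src (act s^-1%g e)) = src e by rewrite -src_act e1e.
  have s_tgt : act s (tgt (act s^-1%g e)) = tgt e by rewrite -tgt_act e1e.
  rewrite -[m](transportVK m s_src) (rep_map_transport _ e1e).
  rewrite (F_act _ _ _ _ s_tgt) (F_map1 _ _ _ e1j).
  by rewrite (F_act _ _ _ _ s_src) (rep_map_transport _ e1e).
have hom_map e m : linfun (F (tgt e)) (rep_map M e m)
    = rep_map N e (linfun (F (src e)) m).
  by rewrite !lfunE; apply: F_map.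
have hom_act v s m : linfun (F (act s v)) (rep_act s m)
    = rep_act s (linfun (F v) m).
  by rewrite !lfunE -!transportE; apply: F_act.
exists (@RatRepHom _ _ _ _ _ _ (fun v => linfun (F v)) hom_map hom_act).
split=> [i w|u uP]; first by rewrite lfunE; apply: F_link.
apply: ratrep_hom_ext => v m; rewrite lfunE.
apply: (F_uniq _ _ _ _ (F v) (u v) (gO v)) => w.
by rewrite (F_act _ _ _ _ (gO v)) F_link [RHS](hom_transport u) uP.
Qed.

End Links.

(** * Linked objects *)

Lemma sum_cast_ord (V : nmodType) m n (E : m = n) (F : 'I_n -> V) :
  \sum_k F k = \sum_k F (cast_ord E k).
Proof. by case: n / E F => F; apply: eq_bigr => k _; rewrite cast_ord_id. Qed.

Section SpeciesOfQuiver.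
Variables (K L : fieldType) (iota : {rmorphism K -> L}).
Variables (Q : ratquiver iota) (D : species_data Q).
Local Notation gal := (gal iota).
Local Notation bimod i j := (sp_bimod (s := quiver_species D) i j).
Local Notation invfield v := (fixfield (stab (v : vert Q))).
Hypothesis algL : forall x : L, algebraicOver iota x.

(** In coordinates for a basis of invariant vectors, the invariants of M(v) are
the row vectors over L(v). *)
Lemma descent_exists (M : ratrep Q) v :
  {W : vectType (invfield v) & {lam : W -> M v | descent_iso lam}}.
Proof.
have [X0 [bX Xinv]] :=
  cid (galois_descent algL (stab_subgroup v) (transport_action M v)).
pose X := in_tuple X0.
exists 'rV[invfield v]_(size X0).
exists (fun r : 'rV[invfield v]_(size X0) => \sum_k fixval (r 0 k) *: X`_k).
have iX (k : 'I_(size X0)) : fixed_vec X`_k.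
  exact: (Xinv _ (mem_nth 0 (ltn_ord k))).
have Xfree : free X by apply: basis_free bX.
split.
- move=> a w w'; rewrite scaler_sumr -big_split; apply: eq_bigr => k _ /=.
  by rewrite !mxE scalerA -scalerDl.
- move=> w w' ww'; apply/rowP => k; apply: val_inj.
  by rewrite /= -(coord_sum_free (fun k => fixval (w 0 k)) k Xfree) ww' coord_sum_free.
- move=> w s sv; rewrite transport_sum; apply: eq_bigr => k _; rewrite iX //.
  by have /asboolP -> := fixvalP (w 0 k).
move=> m mfix.
have cX := coord_invariant (X := X) (transport_action M v) bX Xinv mfix.
exists (\row_k FixField (cX k)); rewrite [RHS](coord_basis (X := X) bX (memvf m)).
by apply: eq_bigr => k _; rewrite mxE.
Qed.

(** Define f_ij by the formula for links; its right-hand side is an invariant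
vector, and it is balanced because [spread] and [arrow] match the actions of
L_i and L_j. *)
Lemma link_species (M : ratrep Q) : exists W, inhabited (link (D := D) M W).
Proof.
pose W i : vectType (sp_field (s := quiver_species D) i) :=
  projT1 (descent_exists M (vrep D i)).
pose lam i : W i -> M (vrep D i) := sval (projT2 (descent_exists M (vrep D i))).
have lamP i : descent_iso (@lam i) := svalP (projT2 (descent_exists M (vrep D i))).
have /all_sig[lamV lamVP] i : {lamV : M (vrep D i) -> W i |
    (forall m, fixed_vec m -> lam i (lamV m) = m) /\ cancel (@lam i) lamV}.
  exact/cid/descent_inv/lamP.
pose F i j w (x : bimod i j) := \sum_e spread x e *: arrow j (lam i w) e.
have F_fix i j w (x : bimod i j) : fixed_vec (F i j w x).
  by apply: arrow_sum_fixed; apply: descent_fixed.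
pose f i j w (x : bimod i j) : W j := lamV j (F i j w x).
have fE i j w (x : bimod i j) : lam j (f i j w x) = F i j w x.
  by rewrite (lamVP j).1.
have f_bal i j : balanced (f i j).
  split.
  - move=> w w' x; apply: (descent_inj (lamP j)).
    rewrite (descentD (lamP j)) !fE -big_split; apply: eq_bigr => e _ /=.
    by rewrite (descentD (lamP i)) arrowD scalerDr.
  - move=> w x x'; apply: (descent_inj (lamP j)).
    rewrite (descentD (lamP j)) !fE -big_split; apply: eq_bigr => e _ /=.
    by rewrite spreadD scalerDl.
  - move=> a w x; apply: (descent_inj (lamP j)); rewrite !fE /F.
    by rewrite (descentZ _ _ (lamP i)) arrow_balanced.
  - move=> w x b; apply: (descent_inj (lamP j)).
    rewrite (descentZ _ _ (lamP j)) !fE scaler_sumr; apply: eq_bigr => e _.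
    by rewrite spread_ract scalerA.
pose f' i j : {linear tensor (W i) (bimod i j) -> W j} :=
  HB.pack (tensor_lift (f i j))
    (GRing.isLinear.Build _ _ _ *:%R _ (tensor_lift_linear (f_bal i j))).
exists (@SpRep (quiver_species D) W f'); constructor.
apply: (@Link _ _ _ _ _ _ (@SpRep (quiver_species D) W f') lam lamP) => i j w x.
by rewrite -[RHS]fE; congr (lam j _); apply: tensor_lift_pure.
Qed.

Section QuiverOfSpecies.
Variable W : sprep (quiver_species D).

(** M(v) is L tensored with W_i over L_i, where L_i is embedded by any
automorphism moving v_i to v.  A basis of W_i gives one of M(v) on which this
choice has no influence, so M(v) is a space of row vectors and G acts on the
entries. *)
Definition vdim (v : vert Q) := \dim {:W (orbit_of v)}.

Lemma vdim_act s v : vdim (act s v) = vdim v.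
Proof.
by rewrite /vdim (@orbit_of_eq _ _ _ _ (orbit_of v)) // orbit_actE mem_orbit_of.
Qed.

Lemma vdim_rep (i : orbits (vert Q)) : vdim (vrep D i) = \dim {:W i}.
Proof. by rewrite /vdim (@orbit_of_eq _ _ _ _ i) // vrepP. Qed.

Definition vcoord i (k : 'I_(\dim {:W i})) (w : W i) : L :=
  fixval (coord (vbasis {:W i}) k w).

Definition structure_const i j (k : 'I_(\dim {:W i})) (l : 'I_(\dim {:W j}))
    (x : bimod i j) : fixfield (stab (vrep D j)) :=
  coord (vbasis {:W j}) l (sprep_map W i j (pure (vbasis {:W i})`_k x)).

Lemma arrow_coef_exists i j (k : 'I_(\dim {:W i})) (l : 'I_(\dim {:W j})) :
  {alpha : edge Q -> L |
    (forall s e, stab (vrep D j) s -> alpha (act s e) = s (alpha e)) /\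
    (forall x : bimod i j,
       \sum_e spread x e * alpha e = fixval (structure_const k l x))}.
Proof.
apply/cid/(trace_duality algL (c := structure_const k l)).
  by move=> x y; rewrite /structure_const pureDr !linearD.
by move=> x b; rewrite /structure_const -scale_pure !linearZ.
Qed.

Definition arrow_coef (i j : orbits (vert Q))
    (k : 'I_(\dim {:W i})) (l : 'I_(\dim {:W j})) :=
  sval (arrow_coef_exists k l).

(** The dual coefficients are meaningful for edges that end at v_j; an arbitrary
edge is moved to such an edge, and the value is moved back. *)
Definition arrow_entry (i j : orbits (vert Q))
    (k : 'I_(\dim {:W i})) (l : 'I_(\dim {:W j})) e : L :=
  let s := carry (vrep D j) (tgt e) in s (arrow_coef k l (act s^-1%g e)).

Lemma arrow_entry_act (i j : orbits (vert Q))
    (k : 'I_(\dim {:W i})) (l : 'I_(\dim {:W j})) s e :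
  tgt e \in val j ->
  arrow_entry k l (act s e) = s (arrow_entry k l e).
Proof.
move=> ej; rewrite /arrow_entry; set g := carry _ (tgt e); set g' := carry _ _.
have gE : act g (vrep D j) = tgt e by apply: carry_orbit ej; apply: vrepP.
have gE' : act g' (vrep D j) = act s (tgt e).
  by rewrite -tgt_act; apply: carryP; exists (s * g)%g; rewrite actM gE tgt_act.
have hj : stab (vrep D j) (g'^-1 * (s * g))%g.
  by rewrite /stab /= !actM gE -gE' actK.
have [aE _] := svalP (arrow_coef_exists k l).
rewrite -[RHS](galVK g') -[RHS]/(g' ((g'^-1 * (s * g))%g _)) -(aE _ _ hj).
by rewrite !actM actVK.
Qed.

Lemma arrow_entry_rep (i j : orbits (vert Q))
    (k : 'I_(\dim {:W i})) (l : 'I_(\dim {:W j})) e :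
  tgt e = vrep D j ->
  arrow_entry k l e = arrow_coef k l e.
Proof.
move=> ej; rewrite /arrow_entry; set g := carry _ _.
have gE : act g (vrep D j) = vrep D j.
  by rewrite /g ej; apply: carryP; exists 1%g; rewrite act1.
have [aE _] := svalP (arrow_coef_exists k l).
by rewrite -aE ?actVK.
Qed.

(** The orbits of the endpoints of e and of s e are equal but not convertible;
only the numerical values of the indices matter. *)
Lemma arrow_entry_cast (i i' j j' : orbits (vert Q))
    (k : 'I_(\dim {:W i})) (k' : 'I_(\dim {:W i'}))
    (l : 'I_(\dim {:W j})) (l' : 'I_(\dim {:W j'})) e : i = i' -> j = j' ->
  k = k' :> nat -> l = l' :> nat ->
  arrow_entry k l e = arrow_entry k' l' e.
Proof.
by move=> ii; case: i' / ii k' => k' jj; case: j' / jj l' => l' /ord_inj-> /ord_inj->.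
Qed.

Definition arrow_mx e : 'M[L]_(vdim (src e), vdim (tgt e)) :=
  \matrix_(k, l) @arrow_entry (orbit_of (src e)) (orbit_of (tgt e)) k l e.

Definition row_act v s (m : 'rV[L]_(vdim v)) : 'rV[L]_(vdim (act s v)) :=
  \row_k s (m 0 (cast_ord (vdim_act s v) k)).

Lemma ecast_row v v' (e : v = v') (m : 'rV[L]_(vdim v)) k
    (E : vdim v' = vdim v) :
  (ecast w 'rV[L]_(vdim w) e m) 0 k = m 0 (cast_ord E k).
Proof. by case: v' / e k E => k E; rewrite cast_ord_id. Qed.

Definition arrow_hom e : 'Hom('rV[L]_(vdim (src e)), 'rV[L]_(vdim (tgt e))) :=
  linfun (mulmxr (arrow_mx e)).

Lemma row_act_bij v s : bijective (@row_act v s).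
Proof.
have E := vdim_act s v.
pose h (m : 'rV[L]_(vdim (act s v))) : 'rV[L]_(vdim v) :=
  \row_k (s^-1)%g (m 0 (cast_ord (esym E) k)).
exists h => m; apply/rowP => k; rewrite !mxE ?galK ?galVK; congr (m 0 _);
  exact: val_inj.
Qed.

Lemma row_actM v s t (m : 'rV[L]_(vdim v)) :
  row_act s (row_act t m)
    = ecast w 'rV[L]_(vdim w) (actM s t v) (row_act (s * t)%g m).
Proof.
apply/rowP => k; rewrite (ecast_row _ _ _ (congr1 vdim (esym (actM s t v)))).
by rewrite !mxE; congr (s (t (m 0 _))); apply: val_inj.
Qed.

Lemma arrow_hom_act s e (m : 'rV[L]_(vdim (src e))) :
  arrow_hom (act s e)
      (ecast w 'rV[L]_(vdim w) (esym (src_act s e)) (row_act s m))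
    = ecast w 'rV[L]_(vdim w) (esym (tgt_act s e)) (row_act s (arrow_hom e m)).
Proof.
have Es := congr1 vdim (src_act s e); have Et := congr1 vdim (tgt_act s e).
have Es' : vdim (src (act s e)) = vdim (src e) by rewrite src_act vdim_act.
apply/rowP => l; rewrite (ecast_row _ _ _ Et) /arrow_hom !lfunE /= !mxE rmorph_sum.
rewrite [RHS](sum_cast_ord Es'); apply: eq_bigr => k _.
rewrite (ecast_row _ _ _ Es) !mxE rmorphM; congr (_ * _).
  by congr (s (m 0 _)); apply: val_inj.
rewrite -arrow_entry_act ?mem_orbit_of //; apply: arrow_entry_cast => //.
  by apply: orbit_of_eq; rewrite src_act orbit_actE mem_orbit_of.
by apply: orbit_of_eq; rewrite tgt_act orbit_actE mem_orbit_of.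
Qed.

Lemma row_act_open v (m : 'rV[L]_(vdim v)) :
  gal_open [set s : gal | exists sv : act s v = v,
    ecast w 'rV[L]_(vdim w) sv (row_act s m) = m].
Proof.
have cE s (sv : act s v = v) k :
    (ecast w 'rV[L]_(vdim w) sv (row_act s m)) 0 k = s (m 0 k).
  rewrite (ecast_row _ _ _ (esym (vdim_act s v))) mxE; congr (s (m 0 _)).
  exact: val_inj.
move=> s [sv sm]; have [r rP] := act_locally_constant s v.
exists (r ++ [seq m 0 k | k <- enum 'I_(vdim v)]) => t ts.
have tv : act t v = v.
  by rewrite rP // => a ar; apply: ts; rewrite mem_cat ar.
exists tv; apply/rowP => k; rewrite cE -{2}sm cE ts // mem_cat.
by apply/orP; right; apply: map_f; rewrite mem_enum.
Qed.

Lemma row_act_add v s (m n : 'rV[L]_(vdim v)) :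
  row_act s (m + n) = row_act s m + row_act s n.
Proof. by apply/rowP => k; rewrite !mxE rmorphD. Qed.

Lemma row_act_semilinear v (s : gal) a (m : 'rV[L]_(vdim v)) :
  row_act s (a *: m) = s a *: row_act s m.
Proof. by apply/rowP => k; rewrite !mxE rmorphM. Qed.

Definition matrix_rep : ratrep Q :=
  @RatRep _ _ _ Q (fun v => 'rV[L]_(vdim v)) row_act arrow_hom row_act_add
    row_act_semilinear row_act_bij row_actM arrow_hom_act row_act_open.

Lemma transport_row v v' s (m : matrix_rep v) k (E : vdim v' = vdim v) :
  act s v = v' ->
  (transport v' s m : 'rV[L]_(vdim v')) 0 k
    = s ((m : 'rV[L]_(vdim v)) 0 (cast_ord E k)).
Proof.
move=> e; case: v' / e k E => k E; rewrite transportE /= mxE.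
by congr (s (m 0 _)); apply: val_inj.
Qed.

Definition rep_row i (w : W i) : matrix_rep (vrep D i) :=
  \row_(k < vdim (vrep D i)) vcoord (cast_ord (vdim_rep i) k) w.

Lemma rep_row_descent i : descent_iso (@rep_row i).
Proof.
split.
- by move=> a w w'; apply/rowP => k; rewrite !mxE /vcoord linearP.
- move=> w w' /rowP ww'.
  rewrite (coord_vbasis (memvf w)) (coord_vbasis (memvf w')).
  apply: eq_bigr => k _; congr (_ *: _); apply: val_inj.
  have := ww' (cast_ord (esym (vdim_rep i)) k); rewrite !mxE.
  by rewrite cast_ordKV.
- move=> w s si; apply/rowP => k; rewrite (transport_row _ _ erefl) // cast_ord_id.
  rewrite mxE /vcoord; set a := coord _ _ w.
  by have /asboolP -> := fixvalP a.
move=> m mfix.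
have mP k : (m : 'rV[L]_(vdim (vrep D i))) 0 k \in fixed (stab (vrep D i)).
  apply/asboolP => s si; have /rowP/(_ k) := mfix s si.
  by rewrite (transport_row _ _ erefl) // cast_ord_id.
pose c k := FixField (mP (cast_ord (esym (vdim_rep i)) k)).
exists (\sum_k c k *: (vbasis {:W i})`_k); apply/rowP => k.
by rewrite mxE /vcoord coord_sum_free ?(basis_free (vbasisP _)) //= cast_ordK.
Qed.

Lemma arrow_row i j (w : W i) e l : tgt e = vrep D j -> src e \in val i ->
  (arrow j (rep_row w) e : 'rV[L]_(vdim (vrep D j))) 0 l
    = \sum_k carry (vrep D i) (src e) (vcoord k w)
        * arrow_coef k (cast_ord (vdim_rep j) l) e.
Proof.
move=> ej ei; have E : vdim (vrep D j) = vdim (tgt e) by rewrite ej.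
rewrite (transport_row _ _ E) ?act1 //= /arrow_hom lfunE /= mxE.
have rE := carry_orbit (vrepP D i) ei.
have Ei : vdim (src e) = \dim {:W i} by rewrite /vdim (orbit_of_eq ei).
have Er : vdim (src e) = vdim (vrep D i) by rewrite Ei vdim_rep.
rewrite [RHS](sum_cast_ord Ei).
apply: eq_bigr => k _; rewrite (transport_row _ _ Er) // !mxE; congr (_ * _).
  by congr (carry _ _ (vcoord _ _)); apply: val_inj.
rewrite -arrow_entry_rep //; apply: arrow_entry_cast => //.
  exact: orbit_of_eq.
by apply: orbit_of_eq; rewrite ej vrepP.
Qed.

(** Expand w in the basis of W_i.  Moving its coordinates into the bimodule
turns each term into an instance of [trace_duality]. *)
Lemma rep_row_map i j (w : W i) (x : bimod i j) :
  rep_row (sprep_map W i j (pure w x))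
    = \sum_e spread x e *: arrow j (rep_row w) e.
Proof.
apply/rowP => l; rewrite mxE; set l' := cast_ord _ l.
rewrite {1}(coord_vbasis (memvf w)).
pose b := vbasis {:W i}.
have -> : pure (\sum_(k < \dim {:W i}) coord b k w *: b`_k) x
    = \sum_(k < \dim {:W i}) pure b`_k (lact (coord b k w) x).
  have pD := @pureDl _ _ _ (bimod i j); have p0 := @pure0l _ _ (W i) (bimod i j) x.
  rewrite (big_morph (fun u => pure u x) (fun u v => pD _ u v x) p0).
  by apply: eq_bigr => k _; rewrite pureZ.
rewrite /vcoord !linear_sum /= summxE.
rewrite (big_morph (@fixval _ _ _ _) (fun _ _ => erefl) erefl).
transitivity (\sum_k \sum_e spread x e *
    (carry (vrep D i) (src e) (vcoord k w) * arrow_coef k l' e)); last first.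
  rewrite exchange_big; apply: eq_bigr => e _; rewrite -mulr_sumr mxE.
  have [_ _ ej ei _|_ ->] := edgeP D i j e; last by rewrite !mul0r.
  by rewrite arrow_row.
apply: eq_bigr => k _.
have [_ aE] := svalP (arrow_coef_exists k l').
rewrite -[LHS]/(fixval (structure_const k l' _)) -aE; apply: eq_bigr => e _.
rewrite mulrA; congr (_ * _).
have [ei|ei] := boolP (src e \in val i); last by rewrite !spread_src ?mul0r.
by rewrite (spread_lact _ _ (carry_orbit (vrepP D i) ei)) mulrC.
Qed.

Lemma link_matrix_rep : link matrix_rep W.
Proof. exact: (Link rep_row_descent rep_row_map). Qed.

End QuiverOfSpecies.

End SpeciesOfQuiver.

Theorem theorem2p35 (K L : fieldType) (iota : {rmorphism K -> L})
    (galL : is_galois iota) (Q : ratquiver iota) (D : species_data Q) :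
  equivalent_categories (ratrep_category Q) (sprep_category (quiver_species D)).
Proof.
have [algL _ _] := galL.
apply: (@equivalence_of_correspondence (ratrep_category Q)
  (sprep_category (quiver_species D)) (link (D := D)) (@related _ _ _ Q D)).
- by move=> M W l i w; rewrite /= !id_lfunE.
- move=> M W l N W' l' P W'' l'' f f' g g' ff' gg' i w.
  by rewrite /= !comp_lfunE ff' gg'.
- exact: link_species.
- by move=> W; exists (matrix_rep algL W); constructor; apply: link_matrix_rep.
- exact: related_lift1.
- exact: related_lift2.
Qed.
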